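(* Let $A$ be a linear operator on a $2$-dimensional complex Hilbert space with eigenvalues $\lambda_1,\lambda_2$ and operator norm $\|A\|$, and let $*$ be pCK or BCK. Then $\mathrm{DW}^{\mathbb R}_*(A)$ is characterized as the unique set $K$ in the family $\mathcal F(\Lambda_1,\Lambda_2)$ of possibly degenerate generalized $h$-elliptical disks with generalized foci $\Lambda_1=\iota^{[2]}_*(\lambda_1)$ and $\Lambda_2=\iota^{[2]}_*(\lambda_2)$ which touches from below the line $z_{\mathrm{pCK}}=\|A\|^2$ (if $*=$ pCK), respectively the line $z_{\mathrm{BCK}}=\frac{\|A\|^2-1}{\|A\|^2+1}$ (if $*=$ BCK); that is, $K$ lies in the closed half-plane below the line and meets the line.
   Context: Conformal range (inner product linear in the first variable): $\mathrm{DW}^{\mathbb R}_{\mathrm{pCK}}(A)=\left\{\left(\frac{\mathrm{Re}\langle \mathbf y,\mathbf x\rangle}{|\mathbf x|^2},\frac{|\mathbf y|^2}{|\mathbf x|^2}\right):\mathbf y=A\mathbf x,\mathbf x\neq0\right\}$ and $\mathrm{DW}^{\mathbb R}_{\mathrm{BCK}}(A)=\left\{\left(\frac{2\,\mathrm{Re}\langle \mathbf y,\mathbf x\rangle}{|\mathbf y|^2+|\mathbf x|^2},\frac{|\mathbf y|^2-|\mathbf x|^2}{|\mathbf y|^2+|\mathbf x|^2}\right): \mathbf y=A\mathbf x,\mathbf x\ne0\right\}$, with coordinates written $(x,z)$. The BCK model of the asymptotically closed hyperbolic plane is the closed unit disk; interior points are ordinary, boundary points asymptotic. The pCK model has base set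 $\{(x,z):x^2\le z\}$ together with one ideal point $\infty_{\langle 0,1\rangle}$, identified with BCK by $(x,z)_{\mathrm{pCK}}\mapsto\left(\frac{2x}{z+1},\frac{z-1}{z+1}\right)_{\mathrm{BCK}}$, $\infty_{\langle 0,1\rangle}\mapsto(0,1)$; hyperbolic notions given in BCK are transported by this bijection. $\iota^{[2]}_{\mathrm{pCK}}(\lambda)=(\mathrm{Re}\lambda,|\lambda|^2)$ and $\iota^{[2]}_{\mathrm{BCK}}(\lambda)=\left(\frac{2\mathrm{Re}\lambda}{|\lambda|^2+1},\frac{|\lambda|^2-1}{|\lambda|^2+1}\right)$; the point is asymptotic iff $\lambda$ is real. Distance of ordinary points in BCK: $\mathrm d(v,w)=\mathrm{arcosh}\frac{1-\langle v,w\rangle}{\sqrt{1-|v|^2}\sqrt{1-|w|^2}}$. For an asymptotic point $p$, the $h$-horocycles with asymptotic point $p$ are the level sets of $b_p(v)=\log\frac{1-\langle v,p\rangle}{\sqrt{1-|v|^2}}$ on ordinary points; for the level set $C$ with value $k$, $\mathrm d_C=b_p-k$ is the signed distance from $C$. Family $\mathcal F(\Lambda_1,\Lambda_2)$: - $\Lambda_1,\Lambda_2$ both ordinary: the sets $\{\boldsymbol x\text{ ordinary}:\mathrm d(\Lambda_1,\boldsymbol x)+\mathrm d(\Lambda_2,\boldsymbol x)\le m\}$ with $m\ge\mathrm d(\Lambda_1,\Lambda_2)$. - One ordinary, say $\Lambda$, the other, $\Lambda_0$, asymptotic: the sets $\{\Lambda_0\}\cup\{\boldsymbol x\text{ ordinary}:\mathrm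 d(\Lambda,\boldsymbol x)+\mathrm d_C(\boldsymbol x)\le0\}$ with $C$ an $h$-horocycle with asymptotic point $\Lambda_0$ and $\mathrm d_C(\Lambda)\le0$. - Both asymptotic and different: the sets $\{\Lambda_1,\Lambda_2\}\cup\{\boldsymbol x\text{ ordinary}:\mathrm d(\boldsymbol x,l)\le r\}$, $r\ge0$, with $l$ the $h$-line (open chord in BCK) connecting $\Lambda_1,\Lambda_2$. - Both asymptotic and equal to $\Lambda$: the single point set $\{\Lambda\}$ and the sets $\{\Lambda\}\cup\{\boldsymbol x\text{ ordinary}: b_\Lambda(\boldsymbol x)\le k\}$, $k\in\mathbb R$ (asymptotically closed $h$-horodisks). *)

(* Defs.v *)
From HB Require Import structures.
From mathcomp Require Import all_boot all_order all_algebra.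
From mathcomp Require Import complex.
From mathcomp Require Import all_classical all_reals all_analysis.

Set Implicit Arguments.
Unset Strict Implicit.
Unset Printing Implicit Defensive.
Import Order.TTheory GRing.Theory Num.Theory.
Local Open Scope classical_set_scope.
Local Open Scope ring_scope.

(* Operators on a complex inner product space: the forms {dot V for Num.conj}
   are linear in the first variable, as is assumed for the conformal range. *)

Definition normsq (R : realType) (V : vectType R[i]) (ip : {dot V for Num.conj})
  (u : V) : R := complex.Re (ip u u).

Definition opnorm (R : realType) (V : vectType R[i]) (ip : {dot V for Num.conj})
  (A : 'End(V)) : R :=
  sup [set Num.sqrt (normsq ip (A u)) / Num.sqrt (normsq ip u)
      | u in [set u : V | u != 0]].

(* The BCK model lives in R * R.  The plane of the pCK model has one additional
   ideal point: Some (x, z) is the point (x, z), None is the point at infinity. *)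

Definition DW_bck (R : realType) (V : vectType R[i]) (ip : {dot V for Num.conj})
  (A : 'End(V)) : set (R * R) :=
  [set (2 * complex.Re (ip (A u) u) / (normsq ip (A u) + normsq ip u),
        (normsq ip (A u) - normsq ip u) / (normsq ip (A u) + normsq ip u))
  | u in [set u : V | u != 0]].

Definition DW_pck (R : realType) (V : vectType R[i]) (ip : {dot V for Num.conj})
  (A : 'End(V)) : set (option (R * R)) :=
  [set Some (complex.Re (ip (A u) u) / normsq ip u,
             normsq ip (A u) / normsq ip u)
  | u in [set u : V | u != 0]].

Definition abssq (R : realType) (l : R[i]) : R := complex.Re (`|l| ^+ 2).

Definition iota_bck (R : realType) (l : R[i]) : R * R :=
  (2 * complex.Re l / (abssq l + 1), (abssq l - 1) / (abssq l + 1)).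

Definition iota_pck (R : realType) (l : R[i]) : option (R * R) :=
  Some (complex.Re l, abssq l).

Definition dotp (R : realType) (v w : R * R) : R := v.1 * w.1 + v.2 * w.2.

Definition ordinary (R : realType) (v : R * R) : Prop := dotp v v < 1.

Definition asymptotic (R : realType) (v : R * R) : Prop := dotp v v = 1.

Definition arcosh (R : realType) (x : R) : R := ln (x + Num.sqrt (x ^+ 2 - 1)).

Definition hdist (R : realType) (v w : R * R) : R :=
  arcosh ((1 - dotp v w)
          / (Num.sqrt (1 - dotp v v) * Num.sqrt (1 - dotp w w))).

Definition hdist_set (R : realType) (v : R * R) (S : set (R * R)) : R :=
  inf [set hdist v w | w in S].

Definition hline (R : realType) (p q : R * R) : set (R * R) :=
  [set ((1 - t) * p.1 + t * q.1, (1 - t) * p.2 + t * q.2)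
  | t in [set t : R | 0 < t < 1]].

Definition busemann (R : realType) (p v : R * R) : R :=
  ln ((1 - dotp v p) / Num.sqrt (1 - dotp v v)).

(* The signed distance from the h-horocycle with asymptotic point p on which
   busemann p takes the value k. *)
Definition horocycle_dist (R : realType) (p : R * R) (k : R) (v : R * R) : R :=
  busemann p v - k.

Definition elliptic_set (R : realType) (L1 L2 : R * R) (m : R) : set (R * R) :=
  [set v | ordinary v /\ hdist L1 v + hdist L2 v <= m].

Definition parabolic_set (R : realType) (L L0 : R * R) (k : R) : set (R * R) :=
  [set L0] `|` [set v | ordinary v /\ hdist L v + horocycle_dist L0 k v <= 0].

Definition hypercyclic_set (R : realType) (L1 L2 : R * R) (r : R) :
    set (R * R) :=
  [set L1] `|` [set L2]
    `|` [set v | ordinary v /\ hdist_set v (hline L1 L2) <= r].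

Definition horodisk (R : realType) (L : R * R) (k : R) : set (R * R) :=
  [set L] `|` [set v | ordinary v /\ busemann L v <= k].

Variant family_bck (R : realType) (L1 L2 : R * R) : set (R * R) -> Prop :=
| TwoOrdinary (m : R) of ordinary L1 & ordinary L2 & hdist L1 L2 <= m :
    family_bck L1 L2 (elliptic_set L1 L2 m)
| OrdinaryAsymptotic (k : R) of
    ordinary L1 & asymptotic L2 & horocycle_dist L2 k L1 <= 0 :
    family_bck L1 L2 (parabolic_set L1 L2 k)
| AsymptoticOrdinary (k : R) of
    asymptotic L1 & ordinary L2 & horocycle_dist L1 k L2 <= 0 :
    family_bck L1 L2 (parabolic_set L2 L1 k)
| TwoAsymptotic (r : R) of
    asymptotic L1 & asymptotic L2 & L1 <> L2 & 0 <= r :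
    family_bck L1 L2 (hypercyclic_set L1 L2 r)
| EqualAsymptoticPoint of asymptotic L1 & L1 = L2 :
    family_bck L1 L2 [set L1]
| EqualAsymptoticHorodisk (k : R) of asymptotic L1 & L1 = L2 :
    family_bck L1 L2 (horodisk L1 k).

Definition pck_base (R : realType) : set (option (R * R)) :=
  [set p | if p is Some (x, z) then x ^+ 2 <= z else True].

Definition pck_to_bck (R : realType) (p : option (R * R)) : R * R :=
  if p is Some (x, z) then (2 * x / (z + 1), (z - 1) / (z + 1)) else (0, 1).

(* pck_to_bck is a bijection from pck_base onto the closed unit disk; the
   family of the pCK model is the one of the BCK model transported along it. *)
Definition family_pck (R : realType) (L1 L2 : option (R * R))
    (K : set (option (R * R))) : Prop :=
  K `<=` @pck_base R
  /\ family_bck (pck_to_bck L1) (pck_to_bck L2) (@pck_to_bck R @` K).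

(* K touches the line z = c from below.  The ideal point of the pCK model is in
   no half-plane. *)
Definition touches_below_bck (R : realType) (c : R) (K : set (R * R)) : Prop :=
  K `<=` [set p | p.2 <= c] /\ K `&` [set p | p.2 = c] !=set0.

Definition touches_below_pck (R : realType) (c : R)
    (K : set (option (R * R))) : Prop :=
  K `<=` Some @` [set p | p.2 <= c]
  /\ K `&` (Some @` [set p | p.2 = c]) !=set0.

(* Main.v *)
Require Import Defs.
From HB Require Import structures.
From mathcomp Require Import all_boot all_order all_algebra.
From mathcomp Require Import complex.
From mathcomp Require Import all_classical all_reals all_analysis.
From mathcomp Require Import ring lra.

(** In the coordinates (x, z) of the pCK model the whole theorem becomes a
    statement about one pencil of conics.  The asymptotic points are the zeros
    of depth (x, z) = z - x^2, and polar is the polarization of that form.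
    For a focus f = (Re l, |l|^2) one has depth f = (Im l)^2, and
    - cosh of the distance of p and q is polar p q / (2 sqrt (depth p depth q));
    - exp (busemann f p) is polar f p / (sqrt (depth p) (f.2 + 1));
    - cosh^2 of the distance of p to the h-line of asymptotic points f, g is
      polar f p * polar g p / (polar f g * depth p).

    Each member of the family of foci f and g is thereby cut out by one and the
    same pair of polynomial inequalities, which depend on a single number
    tau >= 0: this is the set confocal_disk f g tau.  The number tau is read
    off from the size parameter of the member by
    - polar f g + tau = 2 sqrt (depth f depth g) cosh m for two ordinary foci,
    - polar f g + tau = exp k sqrt (depth f) (g.2 + 1) if only g is asymptotic,
    - polar f g + tau = polar f g cosh^2 r for distinct asymptotic foci,
    - tau = (exp k (f.2 + 1))^2 for a horodisk, tau = 0 for a single point,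
    and tau >= 0 is exactly the condition put on m, k or r.  The lemma
    family_confocal collects these five cases.

    On the side of the operator, an orthonormal basis brings A to triangular
    form with diagonal l1, l2 and off-diagonal entry t >= 0 (schur).  The range
    is then an affine image of the sphere of pure states (dw_shell), and
    shell_confocal identifies this image with the confocal disk of parameter
    tau = t^2: along the sphere the defining polynomial is the square of a
    linear form, and conversely its square root supplies a third linear
    equation from which the state can be recovered.

    Finally the highest point of the range lies at the largest eigenvalue c of
    A^* A, which is ||A||^2, and c^2 - (|l1|^2 + |l2|^2 + t^2) c + |l1 l2|^2 = 0
    recovers t from c.  Hence the touching condition selects exactly one tau.
    The BCK half follows because the map between the models preserves the order
    of heights. *)

Set Implicit Arguments.
Unset Strict Implicit.
Unset Printing Implicit Defensive.
Import Order.TTheory GRing.Theory Num.Theory.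
Local Open Scope classical_set_scope.
Local Open Scope ring_scope.

(** * Confocal disks *)

(** Twice the polarization of z - x^2 in the homogeneous coordinates (x, z, 1). *)
Definition polar (R : realType) (p q : R * R) : R := p.2 + q.2 - 2 * p.1 * q.1.

Definition depth (R : realType) (p : R * R) : R := p.2 - p.1 ^+ 2.

(** With M = (polar f g + tau) / (2 sqrt (depth f depth g)) and a, b the
    hyperbolic cosines of the distances from p to f and g, this is
    M^2 - 2 a b M + a^2 + b^2 - 1 without its denominators, so that it also makes
    sense for asymptotic foci. *)
Definition confocal_form (R : realType) (f g : R * R) (tau : R) (p : R * R) : R :=
  ((polar f g + tau) ^+ 2 - 4 * depth f * depth g) * depth p
  + polar f p ^+ 2 * depth g + polar g p ^+ 2 * depth f
  - (polar f g + tau) * polar f p * polar g p.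

(** Distances adding up to at most arcosh M means
    sqrt ((a^2 - 1) (b^2 - 1)) <= M - a b.  The last two inequalities are the
    sign condition and the squared form of this one.  For tau = 0 and
    distinct foci the form vanishes on the line through them and is negative
    elsewhere; the sign condition then cuts out the segment between the foci. *)
Definition confocal_disk (R : realType) (f g : R * R) (tau : R) : set (R * R) :=
  [set p | [/\ 0 <= depth p,
               polar f p * polar g p <= 2 * depth p * (polar f g + tau)
             & 0 <= confocal_form f g tau p]].

Lemma polarC (R : realType) (p q : R * R) : polar p q = polar q p.
Proof. by rewrite /polar; ring. Qed.

Lemma polarE (R : realType) (p q : R * R) : polar p q = (q.1 - p.1) ^+ 2 + depth p + depth q.
Proof. by rewrite /polar /depth; ring. Qed.

Lemma confocal_disk_depth (R : realType) (f g : R * R) tau p :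
  confocal_disk f g tau p -> 0 <= depth p.
Proof. by case. Qed.

Lemma confocal_diskC (R : realType) (f g : R * R) tau : confocal_disk f g tau = confocal_disk g f tau.
Proof.
apply/seteqP; split=> p [d0 h1 h2]; split=> //.
- by rewrite mulrC (polarC g f).
- by move: h2; congr (_ <= _); rewrite /confocal_form (polarC f g); ring.
- by rewrite mulrC (polarC f g).
- by move: h2; congr (_ <= _); rewrite /confocal_form (polarC f g); ring.
Qed.

(** The subtracted square is, up to a factor, the Gram determinant of f, g, p,
    whose sign is the hyperbolic triangle inequality.  For tau > 0 the second
    inequality of confocal_disk can thus be read off from the form. *)
Lemma confocal_form_gram (R : realType) (f g p : R * R) (tau : R) :
  confocal_form f g tau p
  = tau * ((2 * polar f g + tau) * depth p - polar f p * polar g p)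
    - ((g.1 - f.1) * (p.2 - f.2) - (g.2 - f.2) * (p.1 - f.1)) ^+ 2.
Proof. rewrite /confocal_form /depth /polar; ring. Qed.

(** The image in the pCK plane of the complex number x + i y. *)
Definition parab (R : realType) (x y : R) : R * R := (x, x ^+ 2 + y ^+ 2).

Lemma depth_parab (R : realType) (x y : R) : depth (parab x y) = y ^+ 2.
Proof. by rewrite /depth /=; ring. Qed.

Lemma polar_parab (R : realType) (x y : R) (p : R * R) :
  polar (parab x y) p = (p.1 - x) ^+ 2 + depth p + y ^+ 2.
Proof. rewrite /polar /depth /=; ring. Qed.

(** * The image of the sphere of states is a confocal disk *)

(** The values Re <A w, w> and |A w|^2 for A = [[l1, t], [0, l2]] with
    l_j = x_j + i y_j, at a unit vector w = (w1, w2) with |w1|^2 = a,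
    |w2|^2 = b and w2 conj(w1) = u + i v. *)
Definition shell_point (R : realType) (x1 y1 x2 y2 t a b u v : R) : R * R :=
  (x1 * a + x2 * b + t * u,
   (x1 ^+ 2 + y1 ^+ 2) * a + (x2 ^+ 2 + y2 ^+ 2 + t ^+ 2) * b
     + 2 * t * (x1 * u + y1 * v)).

Definition shell (R : realType) (x1 y1 x2 y2 t : R) : set (R * R) :=
  [set p | exists a b u v, [/\ a + b = 1, 0 <= a, 0 <= b, u ^+ 2 + v ^+ 2 = a * b
    & p = shell_point x1 y1 x2 y2 t a b u v]].

(** On the sphere u^2 + v^2 = a b the second summand vanishes and a square is
    left: the boundary of the projection of a sphere is the image of the great
    circle on which a linear form vanishes. *)
Lemma confocal_form_shell (R : realType) (x1 y1 x2 y2 t b u v : R) :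
  let f := parab x1 y1 in let g := parab x2 y2 in
  let e := polar f g + t ^+ 2 in
  confocal_form f g (t ^+ 2) (shell_point x1 y1 x2 y2 t (1 - b) b u v)
  = t ^+ 2 * (2 * y1 * (x2 - x1) * u + (e - 2 * y1 ^+ 2) * v
              + t * y1 * (1 - 2 * b)) ^+ 2
    + (e ^+ 2 - 4 * y1 ^+ 2 * y2 ^+ 2) * t ^+ 2 * ((1 - b) * b - u ^+ 2 - v ^+ 2).
Proof. rewrite /= /confocal_form !depth_parab /depth /polar /=; ring. Qed.

Lemma discr_gt0 (R : realType) (x1 y1 x2 y2 t : R) : 0 < t ->
  0 < (polar (parab x1 y1) (parab x2 y2) + t ^+ 2) ^+ 2 - 4 * y1 ^+ 2 * y2 ^+ 2.
Proof.
move=> t0.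
have E0 : 0 < polar (parab x1 y1) (parab x2 y2) + t ^+ 2.
  by rewrite polar_parab depth_parab /= ltr_wpDl ?exprn_gt0 ?addr_ge0 ?sqr_ge0.
set e := polar _ _ + _ in E0 *.
have -> : e ^+ 2 - 4 * y1 ^+ 2 * y2 ^+ 2
    = 4 * y1 ^+ 2 * ((x2 - x1) ^+ 2 + t ^+ 2) + (e - 2 * y1 ^+ 2) ^+ 2.
  by rewrite /e polar_parab depth_parab /=; ring.
have [->|y1n0] := eqVneq y1 0; first by rewrite expr0n /= !(mulr0, mul0r, add0r, subr0) exprn_gt0.
rewrite ltr_pwDl ?sqr_ge0 // mulr_gt0 ?ltr_wpDl ?sqr_ge0 ?exprn_gt0 //.
by rewrite mulr_gt0 // exprn_even_gt0.
Qed.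

(** Nonnegativity means that the distance of the foci has a hyperbolic cosine
    of at least 1. *)
Lemma discr_ge0 (R : realType) (x1 y1 x2 y2 : R) :
  0 <= polar (parab x1 y1) (parab x2 y2) ^+ 2 - 4 * y1 ^+ 2 * y2 ^+ 2.
Proof.
rewrite polar_parab depth_parab /=.
have := sqr_ge0 (x2 - x1); set d := (_ - _) ^+ 2 => d0.
have -> : (d + y2 ^+ 2 + y1 ^+ 2) ^+ 2 - 4 * y1 ^+ 2 * y2 ^+ 2
  = d * (d + 2 * (y2 ^+ 2 + y1 ^+ 2)) + (y2 ^+ 2 - y1 ^+ 2) ^+ 2 by ring.
by rewrite addr_ge0 ?sqr_ge0 // mulr_ge0 // addr_ge0 // mulr_ge0 // addr_ge0 ?sqr_ge0.
Qed.

Lemma shell_sub_confocal (R : realType) (x1 y1 x2 y2 t : R) : 0 <= t ->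
  shell x1 y1 x2 y2 t `<=` confocal_disk (parab x1 y1) (parab x2 y2) (t ^+ 2).
Proof.
move=> t0 _ [a [b [u [v [ab1 a0 b0 uv ->]]]]].
have ea : a = 1 - b by lra.
rewrite ea in a0 uv * => {a ea ab1}.
set p := shell_point _ _ _ _ _ _ _ _ _.
have Gge0 : 0 <= confocal_form (parab x1 y1) (parab x2 y2) (t ^+ 2) p.
  rewrite confocal_form_shell.
  have -> : (1 - b) * b - u ^+ 2 - v ^+ 2 = 0 by lra.
  by rewrite mulr0 addr0 mulr_ge0 ?sqr_ge0.
have dge0 : 0 <= depth p.
  (* The first square is (Im <A w, w>)^2; the other two sum up to
     |A w|^2 - |<A w, w>|^2, the squared area spanned by w and A w. *)
  pose d := x2 - x1; pose dy := y2 - y1.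
  have -> : depth p = (y1 * (1 - b) + y2 * b + t * v) ^+ 2
      + (t * b - d * u - dy * v) ^+ 2 + (d * v - dy * u) ^+ 2.
    apply/eqP; rewrite -subr_eq0; apply/eqP.
    transitivity ((d ^+ 2 + dy ^+ 2 + t ^+ 2) * ((1 - b) * b - (u ^+ 2 + v ^+ 2))).
      by rewrite /depth /d /dy /=; ring.
    by rewrite uv subrr mulr0.
  by rewrite !addr_ge0 ?sqr_ge0.
split=> //; have [t_gt0|t_le0] := ltrP 0 t.
  move: Gge0; rewrite confocal_form_gram.
  set D := (_ - _) ^+ 2; have D0 : 0 <= D by apply: sqr_ge0.
  have tt : 0 < t ^+ 2 by rewrite exprn_gt0.
  move=> Gge0; rewrite subr_ge0 in Gge0; have {Gge0 D0} := le_trans D0 Gge0.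
  rewrite pmulr_rge0 //; nra.
have t00 : t = 0 by lra.
subst t.
have -> : polar (parab x1 y1) p * polar (parab x2 y2) p = 2 * depth p *
   (polar (parab x1 y1) (parab x2 y2) + 0 ^+ 2)
    - b * (1 - b) * ((polar (parab x1 y1) (parab x2 y2)) ^+ 2 - 4 * y1 ^+ 2 * y2 ^+ 2).
  by rewrite /polar /depth /=; ring.
rewrite gerBl mulr_ge0 ?mulr_ge0 //.
exact: discr_ge0.
Qed.

(** The coordinates of a point give two linear equations for (b, t u, t v),
    and a square root L of confocal_form gives a third.  The determinant of the
    system is minus the quantity of discr_gt0, so Cramer's rule applies; then
    confocal_form_shell, read backwards, puts the solution on the sphere. *)
Lemma confocal_sub_shell (R : realType) (x1 y1 x2 y2 t : R) : 0 < t ->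
  confocal_disk (parab x1 y1) (parab x2 y2) (t ^+ 2) `<=` shell x1 y1 x2 y2 t.
Proof.
move=> t0 p [_ _ G0].
have D0 := discr_gt0 x1 y1 x2 y2 t0.
set e0 := polar _ _ + _ in D0; set D := (e0 ^+ 2 - _) in D0.
pose L := Num.sqrt (confocal_form (parab x1 y1) (parab x2 y2) (t ^+ 2) p).
have LE : L ^+ 2 = confocal_form (parab x1 y1) (parab x2 y2) (t ^+ 2) p.
  by rewrite sqr_sqrtr.
pose d := x2 - x1; pose e := e0 - 2 * y1 ^+ 2.
have DE : D = 4 * y1 ^+ 2 * (d ^+ 2 + t ^+ 2) + e ^+ 2.
  by rewrite /D /e /d /e0 polar_parab depth_parab /=; ring.
pose X := p.1 - x1; pose Y := polar (parab x1 y1) p - 2 * y1 ^+ 2.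
pose Z := L - t ^+ 2 * y1.
pose b := (4 * y1 ^+ 2 * d * X + e * Y - 2 * y1 * Z) / D.
pose u := (X - d * b) / t.
pose v := (e * Z - 2 * y1 * d * e * X + 2 * y1 * (t ^+ 2 + d ^+ 2) * Y) / D / t.
have tn0 : t != 0 by rewrite gt_eqF.
have Dn0 : D != 0 by rewrite gt_eqF.
have e1 : d * b + t * u = X by rewrite /u; field.
have Dn0' : 4 * y1 ^+ 2 * (d ^+ 2 + t ^+ 2) + e ^+ 2 != 0 by rewrite -DE.
have e2 : e * b + 2 * y1 * (t * v) = Y.
  by rewrite /b /v DE; field; rewrite tn0.
have e3 : - (2 * y1 * t ^+ 2 * b) + 2 * y1 * d * (t * u) + e * (t * v) = Z.
  by rewrite /u /v /b DE; field; rewrite tn0.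
clearbody b u v.
have pE : p = shell_point x1 y1 x2 y2 t (1 - b) b u v.
  have p1 : p.1 = x1 + (d * b + t * u) by rewrite e1 /X; ring.
  have p2 : p.2 = 2 * x1 * p.1 - (x1 ^+ 2 + y1 ^+ 2) + 2 * y1 ^+ 2
                  + (e * b + 2 * y1 * (t * v)).
    by rewrite e2 /Y /polar /=; ring.
  rewrite p1 in p2; rewrite (surjective_pairing p) p1 p2 /shell_point.
  congr pair; first by rewrite /d; ring.
  by rewrite /e /e0 /d /polar /=; ring.
have := LE; rewrite {1}pE confocal_form_shell /=.
have -> : L = Z + t ^+ 2 * y1 by rewrite /Z; ring.
rewrite -e3 -/e0 -/e -/d.
have -> : - (2 * y1 * t ^+ 2 * b) + 2 * y1 * d * (t * u) + e * (t * v) + t ^+ 2 * y1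
   = t * (2 * y1 * d * u + e * v + t * y1 * (1 - 2 * b)) by ring.
rewrite exprMn -/D => /eqP; rewrite -subr_eq0 opprD addrA subrr sub0r oppr_eq0.
rewrite !mulf_eq0 (negbTE Dn0) (negbTE tn0) /= => /eqP uv.
exists (1 - b), b, u, v; have := sqr_ge0 u; have := sqr_ge0 v => v0 u0.
by split=> //; [ring|nra|nra|lra].
Qed.

(** For t = 0 both sides degenerate to the segment between the foci: the
    form forces collinearity, and the sign condition selects the points
    between the foci. *)
Lemma confocal0_sub_shell (R : realType) (x1 y1 x2 y2 : R) :
  confocal_disk (parab x1 y1) (parab x2 y2) 0 `<=` shell x1 y1 x2 y2 0.
Proof.
move=> p [dp pp G0].
have mem b : 0 <= b -> b <= 1 -> p = shell_point x1 y1 x2 y2 0 (1 - b) b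
    (Num.sqrt ((1 - b) * b)) 0 -> shell x1 y1 x2 y2 0 p.
  move=> b0 b1 pE; exists (1 - b), b, (Num.sqrt ((1 - b) * b)), 0; split=> //.
  - by ring.
  - by lra.
  - by rewrite expr0n addr0 sqr_sqrtr // mulr_ge0 // subr_ge0.
move: G0; rewrite confocal_form_gram mul0r sub0r oppr_ge0 => G0.
have {G0} D0 : (x2 - x1) * (p.2 - (x1 ^+ 2 + y1 ^+ 2)) -
     (x2 ^+ 2 + y2 ^+ 2 - (x1 ^+ 2 + y1 ^+ 2)) * (p.1 - x1) = 0.
  by apply/eqP; rewrite -sqrf_eq0 eq_le G0 sqr_ge0.
rewrite addr0 in pp.
have [fg|fg] := eqVneq (parab x1 y1) (parab x2 y2).
  have {pp} : ((p.1 - x1) ^+ 2) ^+ 2 + 2 * (p.1 - x1) ^+ 2 * (depth p + y1 ^+ 2)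
      + (depth p - y1 ^+ 2) ^+ 2 <= 0.
    move: pp; rewrite -fg -subr_ge0 -oppr_le0; congr (_ <= _).
    by rewrite !polar_parab depth_parab /=; ring.
  set X := p.1 - x1; move=> H.
  have h1 := sqr_ge0 (X ^+ 2); have h2 := sqr_ge0 (depth p - y1 ^+ 2).
  have h3 : 0 <= 2 * X ^+ 2 * (depth p + y1 ^+ 2).
    by apply: mulr_ge0; [apply: mulr_ge0 => //|apply: addr_ge0 => //]; exact: sqr_ge0.
  have /eqP : (X ^+ 2) ^+ 2 = 0 by lra.
  have /eqP : (depth p - y1 ^+ 2) ^+ 2 = 0 by lra.
  rewrite !sqrf_eq0 /depth => /eqP dE /eqP XE.
  have p1 : p.1 = x1 by rewrite /X in XE; lra.
  apply: (mem 0) => //; rewrite (surjective_pairing p) /shell_point p1.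
  rewrite p1 in dE.
  by congr pair; [ring|lra].
pose P := polar (parab x1 y1) (parab x2 y2).
have Pgt : 0 < P ^+ 2 - 4 * y1 ^+ 2 * y2 ^+ 2.
  rewrite lt_def discr_ge0 andbT; apply: contra fg => /eqP.
  rewrite /P polar_parab depth_parab /=.
  have := sqr_ge0 (x2 - x1); set d := (_ - _) ^+ 2 => d0 H.
  have H1 : 0 <= 2 * d * (y1 ^+ 2 + y2 ^+ 2).
    by apply: mulr_ge0; [apply: mulr_ge0|apply: addr_ge0; exact: sqr_ge0].
  have := sqr_ge0 d; have := sqr_ge0 (y1 ^+ 2 - y2 ^+ 2) => H2 H3.
  have /eqP : (y1 ^+ 2 - y2 ^+ 2) ^+ 2 = 0 by lra.
  have /eqP : d ^+ 2 = 0 by lra.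
  rewrite /d !sqrf_eq0 !subr_eq0 => /eqP -> /eqP yy.
  by rewrite /parab yy.
have [b pE] : exists b, p = shell_point x1 y1 x2 y2 0 (1 - b) b 0 0.
  have [d0|dn0] := eqVneq (x2 - x1) 0.
    have xx : x2 = x1 by lra.
    rewrite d0 mul0r sub0r in D0; move/eqP: D0; rewrite oppr_eq0 mulf_eq0.
    have zn0 : x2 ^+ 2 + y2 ^+ 2 - (x1 ^+ 2 + y1 ^+ 2) != 0.
      apply: contra fg; rewrite subr_eq0 => /eqP zz.
      by rewrite /parab -zz xx.
    rewrite (negbTE zn0) /= => /eqP p1.
    exists ((p.2 - (x1 ^+ 2 + y1 ^+ 2)) / (x2 ^+ 2 + y2 ^+ 2 - (x1 ^+ 2 + y1 ^+ 2))).
    rewrite {1}(surjective_pairing p) /shell_point; congr pair; last by field.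
    by rewrite xx; lra.
  exists ((p.1 - x1) / (x2 - x1)).
  rewrite {1}(surjective_pairing p) /shell_point; congr pair; first by field.
  have -> : p.2 = x1 ^+ 2 + y1 ^+ 2
       + (x2 ^+ 2 + y2 ^+ 2 - (x1 ^+ 2 + y1 ^+ 2)) * (p.1 - x1) / (x2 - x1).
    apply: (mulfI dn0); rewrite mulrDr mulrCA divff // mulr1; lra.
  by field.
have {pp} : 0 <= (1 - b) * b.
  move: pp; rewrite -(pmulr_rge0 _ Pgt) pE -subr_ge0; congr (_ <= _).
  by rewrite /P /polar /depth /=; ring.
move=> bb; apply: (mem b); first nra; first nra.
by rewrite pE; congr pair; rewrite /= !(mulr0, mul0r).
Qed.

Lemma shell_confocal (R : realType) (x1 y1 x2 y2 t : R) : 0 <= t ->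
  shell x1 y1 x2 y2 t = confocal_disk (parab x1 y1) (parab x2 y2) (t ^+ 2).
Proof.
move=> t0; apply/seteqP; split; first exact: shell_sub_confocal.
move: t0; rewrite le_eqVlt => /predU1P[<-|]; last exact: confocal_sub_shell.
by rewrite expr0n; exact: confocal0_sub_shell.
Qed.

(** * The highest point of the range *)

(** The number c is the larger eigenvalue of A^* A, of trace s and determinant
    z1 z2, where z_j = |l_j|^2.  The matrix c - A^* A is positive semidefinite
    with diagonal p, q and determinant 0, and the maximum is attained at the
    state of its null vector. *)
Lemma shell_top (R : realType) (x1 y1 x2 y2 t : R) : 0 <= t ->
  let z1 := x1 ^+ 2 + y1 ^+ 2 in let z2 := x2 ^+ 2 + y2 ^+ 2 in
  let s := z1 + z2 + t ^+ 2 in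
  exists c, [/\ c ^+ 2 - s * c + z1 * z2 = 0, s <= 2 * c
             & touches_below_bck c (shell x1 y1 x2 y2 t)].
Proof.
move=> t0 z1 z2 s.
have z1ge0 : 0 <= z1 by rewrite addr_ge0 ?sqr_ge0.
have z2ge0 : 0 <= z2 by rewrite addr_ge0 ?sqr_ge0.
have t2ge0 : 0 <= t ^+ 2 by rewrite sqr_ge0.
have disc : 0 <= s ^+ 2 - 4 * z1 * z2.
  have -> : s ^+ 2 - 4 * z1 * z2
     = (z1 - z2) ^+ 2 + 2 * (z1 + z2) * t ^+ 2 + (t ^+ 2) ^+ 2 by rewrite /s; ring.
  have := sqr_ge0 (z1 - z2); have := sqr_ge0 (t ^+ 2).
  have : 0 <= (z1 + z2) * t ^+ 2 by rewrite mulr_ge0 // addr_ge0.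
  lra.
pose w := Num.sqrt (s ^+ 2 - 4 * z1 * z2).
have w0 : 0 <= w by apply: sqrtr_ge0.
have w2 : w ^+ 2 = s ^+ 2 - 4 * z1 * z2 by rewrite sqr_sqrtr.
pose c := (s + w) / 2; exists c.
have cE : c ^+ 2 - s * c + z1 * z2 = 0.
  have -> : c ^+ 2 - s * c + z1 * z2 = (w ^+ 2 - (s ^+ 2 - 4 * z1 * z2)) / 4.
    by rewrite /c; field.
  by rewrite w2 subrr mul0r.
have c2 : s <= 2 * c by rewrite /c; lra.
pose p := c - z1; pose q := c - z2 - t ^+ 2.
have pq : p * q = t ^+ 2 * z1.
  by apply/eqP; rewrite -subr_eq0 -cE /p /q /s; apply/eqP; ring.
have pq0 : 0 <= p * q by rewrite pq mulr_ge0.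
have pDq : 0 <= p + q by rewrite /p /q; rewrite /s in c2; lra.
have p0 : 0 <= p by nra.
have q0 : 0 <= q by nra.
have height a b u v : a + b = 1 -> c - (shell_point x1 y1 x2 y2 t a b u v).2
   = p * a + q * b - 2 * t * (x1 * u + y1 * v).
  move=> ab; have {1}-> : c = c * (a + b) by rewrite ab mulr1.
  by rewrite /p /q /z1 /z2 /=; ring.
split=> //; split.
  move=> _ [a [b [u [v [ab a0 b0 uv ->]]]]].
  rewrite /set_of /mkset -subr_ge0 height // subr_ge0.
  set h := p * a + q * b.
  have h0 : 0 <= h by rewrite addr_ge0 // mulr_ge0.
  rewrite (le_trans (ler_norm _)) // -ler_sqr ?nnegrE // real_normK ?num_real //.
  have -> : (2 * t * (x1 * u + y1 * v)) ^+ 2 = 4 * (p * q) * (a * b)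
      - 4 * t ^+ 2 * (y1 * u - x1 * v) ^+ 2.
    by rewrite pq -uv /z1; ring.
  have := sqr_ge0 (p * a - q * b).
  have : 0 <= t ^+ 2 * (y1 * u - x1 * v) ^+ 2 by rewrite mulr_ge0 ?sqr_ge0.
  have -> : (p * a - q * b) ^+ 2 = h ^+ 2 - 4 * (p * q) * (a * b).
    by rewrite /h; ring.
  lra.
have [e|n] := eqVneq (p + q) 0.
  exists (shell_point x1 y1 x2 y2 t 1 0 0 0); split.
    by exists 1, 0, 0, 0; split=> //; ring.
  have := height 1 0 0 0 (addr0 1); rewrite /mkset; lra.
exists (shell_point x1 y1 x2 y2 t (q / (p + q)) (p / (p + q))
   (t * x1 / (p + q)) (t * y1 / (p + q))); split.
  do 4!eexists; split; last by []; try by rewrite divr_ge0.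
    by field.
  apply: (mulIf (expf_neq0 2 n)); transitivity (t ^+ 2 * z1).
    by rewrite /z1; field.
  by rewrite -pq; field.
apply/esym/eqP; rewrite -subr_eq0 height; last by field.
apply/eqP; transitivity (2 * (p * q - t ^+ 2 * z1) / (p + q)).
  by rewrite /z1; field.
by rewrite pq subrr mulr0 mul0r.
Qed.

Lemma touches_below_unique (R : realType) (c c' : R) (K : set (R * R)) :
  touches_below_bck c K -> touches_below_bck c' K -> c = c'.
Proof.
move=> [Kc [p [Kp pc]]] [Kc' [p' [Kp' pc']]].
have := Kc _ Kp'; have := Kc' _ Kp.
rewrite /mkset in pc pc' *; rewrite pc pc' => h1 h2.
by apply/le_anti; rewrite h1 h2.
Qed.

(** The quadratic equation of shell_top is linear in t^2 with coefficient c; for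
    c = 0 the bound s <= 2 c makes t vanish. *)
Lemma shell_touch_inj (R : realType) (x1 y1 x2 y2 t t' c : R) :
  0 <= t -> 0 <= t' -> touches_below_bck c (shell x1 y1 x2 y2 t) ->
  touches_below_bck c (shell x1 y1 x2 y2 t') -> t = t'.
Proof.
move=> t0 t'0 h h'.
have [c1 [eq1 le1 /(touches_below_unique h) cc1]] := shell_top x1 y1 x2 y2 t0.
have [c2 [eq2 le2 /(touches_below_unique h') cc2]] := shell_top x1 y1 x2 y2 t'0.
subst c1; subst c2.
set s := _ + t ^+ 2 in eq1 le1; set s' := _ + t' ^+ 2 in eq2 le2.
suff ss : s = s'.
  have : t ^+ 2 = t' ^+ 2 by rewrite /s /s' in ss; lra.
  by move/eqP; rewrite eqrXn2 // => /eqP.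
have : c * (s - s') = 0 by lra.
move/eqP; rewrite mulf_eq0 subr_eq0 => /orP[/eqP c0|/eqP //].
have s0 : 0 <= s by rewrite !addr_ge0 ?sqr_ge0.
have s'0 : 0 <= s' by rewrite !addr_ge0 ?sqr_ge0.
rewrite c0 in le1 le2; lra.
Qed.

(** * Inverse hyperbolic cosine *)

Definition cosh (R : realType) (m : R) : R := (expR m + expR (- m)) / 2.

Section Arcosh.
Variable R : realType.
Implicit Types a b q m k : R.

Lemma cosh_ge1 m : 1 <= cosh m.
Proof.
rewrite /cosh; have := expRxMexpNx_1 m; have := expR_gt0 m; have := expR_gt0 (- m).
move: (expR m) (expR (- m)) => x y y0 x0 xy.
have := sqr_ge0 (x - y); nra.
Qed.

Lemma sqr_m1_ge0 a : 1 <= a -> 0 <= a ^+ 2 - 1.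
Proof. by move=> a1; rewrite subr_ge0 -(expr1n R 2) ler_sqr ?nnegrE //; lra. Qed.

Lemma arcosh_exp_ge1 a : 1 <= a -> 1 <= a + Num.sqrt (a ^+ 2 - 1).
Proof. by move=> a1; rewrite ler_wpDr ?sqrtr_ge0. Qed.

Lemma arcosh_ge0 a : 1 <= a -> 0 <= arcosh a.
Proof. by move=> a1; rewrite ln_ge0 // arcosh_exp_ge1. Qed.

Lemma expR_arcosh a : 1 <= a -> expR (arcosh a) = a + Num.sqrt (a ^+ 2 - 1).
Proof. by move=> a1; rewrite lnK // posrE (lt_le_trans ltr01) // arcosh_exp_ge1. Qed.

Lemma cosh_arcosh a : 1 <= a -> cosh (arcosh a) = a.
Proof.
move=> a1; rewrite /cosh expRN expR_arcosh //.
have := arcosh_exp_ge1 a1; have := sqr_sqrtr (sqr_m1_ge0 a1).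
move: (Num.sqrt _) => w w2 w1.
have n0 : a + w != 0 by rewrite gt_eqF //; lra.
have -> : (a + w)^-1 = a - w by apply: (mulfI n0); rewrite divff //; lra.
by lra.
Qed.

(** Both sides are polynomial in q and exp m, which suits Busemann functions:
    they enter exponentiated. *)
Lemma arcosh_le_exp q m : 1 <= q ->
  arcosh q <= m <-> q <= expR m /\ 2 * expR m * q <= expR m ^+ 2 + 1.
Proof.
move=> q1; rewrite -ler_expR expR_arcosh // -lerBrDl.
have q2 := sqr_m1_ge0 q1; move: (expR m) => k; split.
  move=> h; have kq : 0 <= k - q by apply: le_trans h; apply: sqrtr_ge0.
  split; first by rewrite -subr_ge0.
  by move: h; rewrite -ler_sqr ?nnegrE ?sqrtr_ge0 // sqr_sqrtr //; lra.
move=> [h1 h2]; rewrite -ler_sqr ?nnegrE ?sqrtr_ge0 ?subr_ge0 // sqr_sqrtr //; lra.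
Qed.

Lemma arcosh_le q m : 1 <= q -> 0 <= m -> (arcosh q <= m) = (q <= cosh m).
Proof.
move=> q1 m0; apply/idP/idP => [/(arcosh_le_exp _ q1)[_]|h].
  rewrite /cosh expRN; have := expR_gt0 m; move: (expR m) => k k0 h.
  have -> : (k + k^-1) / 2 = (k ^+ 2 + 1) / (2 * k) by field; rewrite gt_eqF.
  by rewrite ler_pdivlMr ?mulr_gt0 //; lra.
apply/(arcosh_le_exp _ q1); move: h; rewrite /cosh expRN.
have k1 : 1 <= expR m by rewrite leNgt expR_lt1 -leNgt.
move: (expR m) k1 => k k1.
have k0 : 0 < k by lra.
have ki : k^-1 <= 1 by rewrite invf_le1.
move=> h; split; first by lra.
have kk : k * k^-1 = 1 by rewrite divff // gt_eqF.
have : 0 <= k * ((k + k^-1) / 2 - q) by rewrite mulr_ge0 // ?subr_ge0 // ltW.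
lra.
Qed.

Lemma ler_arcosh a b : 1 <= a -> a <= b -> arcosh a <= arcosh b.
Proof.
move=> a1 ab; have b1 := le_trans a1 ab.
by rewrite arcosh_le ?arcosh_ge0 // cosh_arcosh.
Qed.

(** The addition theorem of cosh. *)
Lemma arcosh_add a b : 1 <= a -> 1 <= b ->
  arcosh a + arcosh b
  = arcosh (a * b + Num.sqrt (a ^+ 2 - 1) * Num.sqrt (b ^+ 2 - 1)).
Proof.
move=> a1 b1; rewrite /arcosh -lnM ?posrE; last 2 first.
- by rewrite (lt_le_trans ltr01) // arcosh_exp_ge1.
- by rewrite (lt_le_trans ltr01) // arcosh_exp_ge1.
congr ln; have := sqr_sqrtr (sqr_m1_ge0 a1); have := sqr_sqrtr (sqr_m1_ge0 b1).
have := sqrtr_ge0 (a ^+ 2 - 1); have := sqrtr_ge0 (b ^+ 2 - 1).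
move: (Num.sqrt (a ^+ 2 - 1)) (Num.sqrt (b ^+ 2 - 1)) => u v v0 u0 v2 u2.
have -> : (a * b + u * v) ^+ 2 - 1 = (a * v + b * u) ^+ 2.
  have -> : (a * b + u * v) ^+ 2 = a ^+ 2 * b ^+ 2 + 2 * a * b * u * v + u ^+ 2 * v ^+ 2 by ring.
  have -> : (a * v + b * u) ^+ 2 = a ^+ 2 * v ^+ 2 + 2 * a * b * u * v + b ^+ 2 * u ^+ 2 by ring.
  by rewrite u2 v2; ring.
rewrite sqrtr_sqr ger0_norm; first by ring.
by rewrite addr_ge0 // mulr_ge0 //; lra.
Qed.

Lemma arcosh_add_le a b m : 1 <= a -> 1 <= b -> 0 <= m ->
  arcosh a + arcosh b <= m <->
  a * b <= cosh m /\ 2 * a * b * cosh m <= cosh m ^+ 2 + a ^+ 2 + b ^+ 2 - 1.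
Proof.
move=> a1 b1 m0; rewrite arcosh_add // arcosh_le //; last first.
  rewrite ler_wpDr ?mulr_ge0 ?sqrtr_ge0 // -(mulr1 1) ler_pM //.
rewrite -lerBrDl -sqrtrM ?sqr_m1_ge0 //.
have ab0 : 0 <= (a ^+ 2 - 1) * (b ^+ 2 - 1) by rewrite mulr_ge0 ?sqr_m1_ge0.
move: (cosh m) => M; split=> [h|[h1 h2]].
  have kq : 0 <= M - a * b by apply: le_trans h; apply: sqrtr_ge0.
  split; first by rewrite -subr_ge0.
  by move: h; rewrite -ler_sqr ?nnegrE ?sqrtr_ge0 // sqr_sqrtr //; lra.
rewrite -ler_sqr ?nnegrE ?sqrtr_ge0 ?subr_ge0 // sqr_sqrtr //; lra.
Qed.

Lemma cosh_surj (M : R) : 1 <= M -> exists2 m, 0 <= m & cosh m = M.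
Proof. by move=> M1; exists (arcosh M); rewrite ?arcosh_ge0 ?cosh_arcosh. Qed.

End Arcosh.

(** * The conformal map onto the disk *)

Definition to_disk (R : realType) (p : R * R) : R * R := pck_to_bck (Some p).

Section Model.
Variable R : realType.
Implicit Types p q f g v w : R * R.

Lemma height_gt0 p : 0 <= depth p -> 0 < p.2 + 1.
Proof. by rewrite /depth => h; have := sqr_ge0 p.1; lra. Qed.

(** The map onto the disk is projective: it transports the polar form up to
    the factors z + 1. *)
Lemma dotp_to_disk p q : 0 < p.2 + 1 -> 0 < q.2 + 1 ->
  1 - dotp (to_disk p) (to_disk q) = 2 * polar p q / ((p.2 + 1) * (q.2 + 1)).
Proof.
case: p q => [x z] [x' z'] /= h h'; rewrite /dotp /polar /=.
by field; rewrite !gt_eqF.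
Qed.

Lemma dotp_to_diskE p : 0 < p.2 + 1 ->
  1 - dotp (to_disk p) (to_disk p) = 4 * depth p / (p.2 + 1) ^+ 2.
Proof.
move=> h; rewrite dotp_to_disk //.
have -> : polar p p = 2 * depth p by rewrite /polar /depth; ring.
by field; rewrite gt_eqF.
Qed.

Lemma ordinary_to_disk p : 0 <= depth p -> ordinary (to_disk p) <-> 0 < depth p.
Proof.
move=> /height_gt0 h; rewrite /ordinary -subr_gt0 dotp_to_diskE //.
by rewrite pmulr_lgt0 ?invr_gt0 ?exprn_gt0 // pmulr_rgt0.
Qed.

Lemma asymptotic_to_disk p : 0 <= depth p -> asymptotic (to_disk p) <-> depth p = 0.
Proof.
move=> d0; have h := height_gt0 d0; rewrite /asymptotic.
have E := dotp_to_diskE h; split => H.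
  move: E; rewrite H subrr => /esym/eqP.
  rewrite !mulf_eq0 pnatr_eq0 /= invr_eq0 expf_eq0 /= (gt_eqF h) orbF.
  by move/eqP.
by move: E; rewrite H mulr0 mul0r => /eqP; rewrite subr_eq0 => /eqP.
Qed.

Lemma to_disk_inj p q : 0 <= depth p -> 0 <= depth q -> to_disk p = to_disk q -> p = q.
Proof.
move=> /height_gt0 h /height_gt0 h'; case: p q h h' => [x z] [x' z'] /= h h'.
case=> e1 e2.
have zz : z = z'.
  have e (y : R) : 0 < y + 1 -> (y - 1) / (y + 1) = 1 - 2 / (y + 1).
    by move=> y1; field; rewrite gt_eqF.
  move: e2; rewrite !e // => /addrI /oppr_inj /mulfI.
  by rewrite pnatr_eq0 => /(_ isT) /invr_inj; lra.
congr pair=> //; subst z'; move: e1 => /mulIf; rewrite invr_eq0 gt_eqF // => /(_ isT).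
lra.
Qed.

Lemma ordinary_to_disk_ex v : ordinary v -> exists2 p, 0 < depth p & to_disk p = v.
Proof.
case: v => a b; rewrite /ordinary /dotp /= => h.
have b1 : 0 < 1 - b by have := sqr_ge0 a; nra.
have b1n : 1 - b != 0 by rewrite gt_eqF.
exists (a / (1 - b), (1 + b) / (1 - b)).
  rewrite /depth /=.
  have -> : (1 + b) / (1 - b) - (a / (1 - b)) ^+ 2 = (1 - (a * a + b * b)) / (1 - b) ^+ 2.
    by field.
  by rewrite divr_gt0 ?exprn_gt0 // subr_gt0.
have e : (1 + b) / (1 - b) + 1 = 2 / (1 - b) by field.
by rewrite /to_disk /=; congr pair; rewrite e; field.
Qed.

Lemma to_disk_neq_ideal p : 0 <= depth p -> to_disk p <> (0, 1).
Proof.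
move=> /height_gt0; case: p => x z /= z1 [_ /(congr1 (fun y => y * (z + 1)))].
by rewrite divfK ?gt_eqF // mul1r; lra.
Qed.

Lemma sqrt_to_disk p : 0 <= depth p ->
  Num.sqrt (1 - dotp (to_disk p) (to_disk p)) = 2 * Num.sqrt (depth p) / (p.2 + 1).
Proof.
move=> d0; have h := height_gt0 d0.
have -> : 1 - dotp (to_disk p) (to_disk p) = (2 * Num.sqrt (depth p) / (p.2 + 1)) ^+ 2.
  rewrite dotp_to_diskE // exprMn exprMn sqr_sqrtr //.
  by field; rewrite gt_eqF.
by rewrite sqrtr_sqr ger0_norm // divr_ge0 ?mulr_ge0 ?sqrtr_ge0 // ltW.
Qed.

Lemma hdist_to_disk p q : 0 < depth p -> 0 < depth q ->
  hdist (to_disk p) (to_disk q)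
  = arcosh (polar p q / (2 * Num.sqrt (depth p) * Num.sqrt (depth q))).
Proof.
move=> dp dq; have hp := height_gt0 (ltW dp); have hq := height_gt0 (ltW dq).
rewrite /hdist !sqrt_to_disk ?ltW // dotp_to_disk //; congr arcosh.
by field; rewrite !gt_eqF ?sqrtr_gt0.
Qed.

Lemma polar_ge p q : 0 <= depth p -> 0 <= depth q ->
  2 * Num.sqrt (depth p) * Num.sqrt (depth q) <= polar p q.
Proof.
move=> dp dq; rewrite polarE.
have := sqr_sqrtr dp; have := sqr_sqrtr dq; have := sqr_ge0 (q.1 - p.1).
by have := sqr_ge0 (Num.sqrt (depth p) - Num.sqrt (depth q)); lra.
Qed.

Lemma hdist_arg_ge1 p q : 0 < depth p -> 0 < depth q ->
  1 <= polar p q / (2 * Num.sqrt (depth p) * Num.sqrt (depth q)).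
Proof.
move=> dp dq; rewrite ler_pdivlMr ?mul1r ?polar_ge ?ltW //.
by rewrite !mulr_gt0 // sqrtr_gt0.
Qed.

Lemma busemann_to_disk f p : depth f = 0 -> 0 < depth p ->
  busemann (to_disk f) (to_disk p)
  = ln (polar f p / (Num.sqrt (depth p) * (f.2 + 1))).
Proof.
move=> df dp; have hp := height_gt0 (ltW dp).
have hf : 0 < f.2 + 1 by apply: height_gt0; rewrite df.
rewrite /busemann sqrt_to_disk ?ltW // dotp_to_disk // polarC; congr ln.
by field; rewrite !gt_eqF ?sqrtr_gt0.
Qed.

Lemma polar_boundary_gt0 f p : depth f = 0 -> 0 < depth p -> 0 < polar f p.
Proof. by move=> df dp; rewrite polarE df addr0 ltr_wpDl ?sqr_ge0. Qed.

Lemma polar_two_boundary f g : depth f = 0 -> depth g = 0 -> f <> g -> 0 < polar f g.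
Proof.
move=> df dg fg; rewrite polarE df dg !addr0 lt_def sqr_ge0 andbT sqrf_eq0.
apply/eqP => e; apply: fg.
have e1 : g.1 = f.1 by lra.
rewrite (surjective_pairing f) (surjective_pairing g) e1; congr pair.
by move: df dg; rewrite /depth e1; lra.
Qed.

(** A point of the chord is (1 - t) f + t g with f, g on the unit circle.
    With a = 1 - <p, f> and b = 1 - <p, g>, the hyperbolic cosine of its
    distance from p is proportional to ((1 - t) a + t b) / sqrt (t (1 - t)).
    By the inequality of the means this is least where (1 - t) a = t b. *)
Lemma hdist_set_hline f g p : depth f = 0 -> depth g = 0 -> f <> g -> 0 < depth p ->
  1 <= Num.sqrt (polar f p * polar g p / (polar f g * depth p)) /\
  hdist_set (to_disk p) (hline (to_disk f) (to_disk g))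
  = arcosh (Num.sqrt (polar f p * polar g p / (polar f g * depth p))).
Proof.
move=> df dg fg dp.
have Ef := polar_boundary_gt0 df dp; have Eg := polar_boundary_gt0 dg dp.
have Efg := polar_two_boundary df dg fg.
have hf : 0 < f.2 + 1 by apply: height_gt0; rewrite df.
have hg : 0 < g.2 + 1 by apply: height_gt0; rewrite dg.
have hp := height_gt0 (ltW dp).
pose a := 1 - dotp (to_disk p) (to_disk f).
pose b := 1 - dotp (to_disk p) (to_disk g).
pose c := 1 - dotp (to_disk f) (to_disk g).
pose S := 1 - dotp (to_disk p) (to_disk p).
have aE : a = 2 * polar f p / ((p.2 + 1) * (f.2 + 1)) by rewrite /a dotp_to_disk // polarC.
have bE : b = 2 * polar g p / ((p.2 + 1) * (g.2 + 1)) by rewrite /b dotp_to_disk // polarC.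
have cE : c = 2 * polar f g / ((f.2 + 1) * (g.2 + 1)) by rewrite /c dotp_to_disk.
have SE : S = 4 * depth p / (p.2 + 1) ^+ 2 by rewrite /S dotp_to_diskE.
have a0 : 0 < a by rewrite aE divr_gt0 ?mulr_gt0.
have b0 : 0 < b by rewrite bE divr_gt0 ?mulr_gt0.
have c0 : 0 < c by rewrite cE divr_gt0 ?mulr_gt0.
have S0 : 0 < S by rewrite SE divr_gt0 ?exprn_gt0 ?mulr_gt0.
have QE : polar f p * polar g p / (polar f g * depth p) = 2 * a * b / (c * S).
  by rewrite aE bE cE SE; field; rewrite !gt_eqF.
have Q1 : 1 <= polar f p * polar g p / (polar f g * depth p).
  rewrite ler_pdivlMr ?mulr_gt0 // mul1r -subr_ge0.
  have -> : polar f p * polar g p - polar f g * depth p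
      = ((p.1 - f.1) * (p.1 - g.1) + depth p) ^+ 2.
    by rewrite !polarE df dg; ring.
  exact: sqr_ge0.
set Q := _ / _ in QE Q1 *.
have Q0 : 0 <= Q by lra.
have sQ1 : 1 <= Num.sqrt Q by rewrite -[X in X <= _]sqrtr1 ler_sqrt //; lra.
split=> //.
pose w t : R * R := ((1 - t) * (to_disk f).1 + t * (to_disk g).1,
  (1 - t) * (to_disk f).2 + t * (to_disk g).2).
have F1 : dotp (to_disk f) (to_disk f) = 1 by apply/asymptotic_to_disk; rewrite df.
have G1 : dotp (to_disk g) (to_disk g) = 1 by apply/asymptotic_to_disk; rewrite dg.
have vw t : 1 - dotp (to_disk p) (w t) = (1 - t) * a + t * b.
  by rewrite /a /b /dotp /=; ring.
have ww t : 1 - dotp (w t) (w t) = 2 * t * (1 - t) * c.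
  transitivity (1 - (1 - t) ^+ 2 * dotp (to_disk f) (to_disk f)
     - t ^+ 2 * dotp (to_disk g) (to_disk g) - 2 * t * (1 - t) * dotp (to_disk f) (to_disk g)).
    by rewrite /dotp /w /=; ring.
  by rewrite F1 G1 /c; ring.
have arg t : 0 < t < 1 ->
    ((1 - dotp (to_disk p) (w t)) / (Num.sqrt S * Num.sqrt (1 - dotp (w t) (w t))))
    = Num.sqrt (((1 - t) * a + t * b) ^+ 2 / (S * (2 * t * (1 - t) * c))).
  move=> /andP[t0 t1]; rewrite vw ww.
  have t1' : 0 < 1 - t by lra.
  have n0 : 0 < (1 - t) * a + t * b by rewrite addr_gt0 // mulr_gt0.
  have m0 : 0 < 2 * t * (1 - t) * c by rewrite !mulr_gt0.
  rewrite -sqrtrM ?ltW // [RHS]sqrtrM ?sqr_ge0 // sqrtr_sqr gtr0_norm // sqrtrV //.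
  by rewrite mulr_ge0 // ltW.
have low t : 0 < t < 1 -> arcosh (Num.sqrt Q) <= hdist (to_disk p) (w t).
  move=> t01; rewrite /hdist -/S arg //; apply: ler_arcosh => //.
  move: t01 => /andP[t0 t1]; have t1' : 0 < 1 - t by lra.
  rewrite ler_wsqrtr // QE ler_pdivrMr ?mulr_gt0 // [X in _ <= X]mulrAC ler_pdivlMr ?mulr_gt0 //.
  have : 0 <= c * S * ((1 - t) * a - t * b) ^+ 2 by rewrite mulr_ge0 ?sqr_ge0 // mulr_ge0 // ltW.
  lra.
pose t0 := a / (a + b).
have ab0 : 0 < a + b by rewrite addr_gt0.
have t01 : 0 < t0 < 1.
  by rewrite divr_gt0 //= ltr_pdivrMr // mul1r ltrDl.
have E0 : hdist (to_disk p) (w t0) = arcosh (Num.sqrt Q).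
  rewrite /hdist -/S arg // QE; congr (arcosh (Num.sqrt _)).
  by rewrite /t0; field; rewrite !gt_eqF //; lra.
have mem : [set hdist (to_disk p) w | w in hline (to_disk f) (to_disk g)] (arcosh (Num.sqrt Q)).
  by exists (w t0) => //; exists t0.
have lb : lbound [set hdist (to_disk p) w | w in hline (to_disk f) (to_disk g)] (arcosh (Num.sqrt Q)).
  by move=> _ [_ [t tt <-] <-]; apply: low.
apply/le_anti; rewrite ge_inf //=; last by exists (arcosh (Num.sqrt Q)).
by apply: lb_le_inf => //; exists (arcosh (Num.sqrt Q)).
Qed.

Lemma horocycle_le f g k : 0 < depth f -> depth g = 0 ->
  (horocycle_dist (to_disk g) k (to_disk f) <= 0)
  = (polar f g <= expR k * Num.sqrt (depth f) * (g.2 + 1)).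
Proof.
move=> df dg; have s0 : 0 < Num.sqrt (depth f) by rewrite sqrtr_gt0.
have hg : 0 < g.2 + 1 by apply: height_gt0; rewrite dg.
have E := polar_boundary_gt0 dg df.
rewrite /horocycle_dist busemann_to_disk // subr_le0 -[LHS]ler_expR lnK ?posrE ?divr_gt0 ?mulr_gt0 //.
by rewrite ler_pdivrMr ?mulr_gt0 // mulrA polarC.
Qed.

End Model.

(** * The family of generalized elliptical disks *)

Section Family.
Variable R : realType.
Implicit Types (p q f g v w : R * R) (m k r tau : R).

Lemma polar_boundary f p : 0 <= depth f -> depth p = 0 ->
  0 <= polar f p ?= iff ((depth f == 0) && (p == f)).
Proof.
move=> df dp; rewrite polarE dp addr0; split.
  by rewrite addr_ge0 ?sqr_ge0.
rewrite eq_sym paddr_eq0 ?sqr_ge0 // sqrf_eq0 andbC.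
have [d0|] //= := eqVneq (depth f) 0.
apply/eqP/eqP => [e|->]; last by rewrite subrr.
have e1 : p.1 = f.1 by lra.
rewrite (surjective_pairing p) (surjective_pairing f) e1; congr pair.
by move: d0 dp; rewrite /depth e1; lra.
Qed.

(** At an asymptotic point the second inequality of confocal_disk turns into
    polar f p * polar g p <= 0, although both factors are nonnegative. *)
Lemma confocal_boundary f g tau p : 0 <= depth f -> 0 <= depth g -> depth p = 0 ->
  confocal_disk f g tau p <-> (depth f = 0 /\ p = f) \/ (depth g = 0 /\ p = g).
Proof.
move=> df dg dp.
have [pf pf'] := polar_boundary df dp; have [pg pg'] := polar_boundary dg dp.
split=> [[_ h _]|].
  have : polar f p * polar g p == 0.
    by rewrite eq_le mulr_ge0 // andbT; move: h; rewrite dp mulr0 mul0r.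
  rewrite mulf_eq0 (eq_sym (polar f p)) (eq_sym (polar g p)) pf' pg'.
  by case/orP=> /andP[/eqP -> /eqP ->]; [left|right].
rewrite /confocal_disk /confocal_form /mkset dp => -[] [e ->].
  have -> : polar f f = 0 by rewrite polarE subrr e expr0n !addr0.
  by split=> //; rewrite ?e; lra.
have -> : polar g g = 0 by rewrite polarE subrr e expr0n !addr0.
by split=> //; rewrite ?e; lra.
Qed.

(** Asymptotic points are taken care of once and for all here, so that each kind
    of member only has to be compared at ordinary points. *)
Lemma to_disk_confocal f g tau (P : set (R * R)) : 0 <= depth f -> 0 <= depth g ->
  (forall p, 0 < depth p -> P (to_disk p) <-> confocal_disk f g tau p) ->
  forall v, (@to_disk R @` confocal_disk f g tau) v <->
    (ordinary v /\ P v) \/ (depth f = 0 /\ v = to_disk f)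
    \/ (depth g = 0 /\ v = to_disk g).
Proof.
move=> df dg HP v; split.
  move=> [p cp <-]; have [dp _ _] := cp.
  have [d0|dn0] := eqVneq (depth p) 0.
    right; have /(confocal_boundary _ df dg d0) := cp.
    by case=> [[? ->]|[? ->]]; [left|right].
  have dp' : 0 < depth p by rewrite lt_def dn0.
  by left; split; [apply/ordinary_to_disk|apply/HP].
case=> [[/ordinary_to_disk_ex[p dp <-] /(HP _ dp)]|].
  by exists p.
case=> [] [d0 ->]; [exists f|exists g] => //; apply/confocal_boundary => //.
  by left.
by right.
Qed.

Lemma elliptic_confocal f g m tau : 0 < depth f -> 0 < depth g -> 0 <= m ->
  polar f g + tau = 2 * Num.sqrt (depth f) * Num.sqrt (depth g) * cosh m ->
  elliptic_set (to_disk f) (to_disk g) m = @to_disk R @` confocal_disk f g tau.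
Proof.
move=> df dg m0 E0.
pose P : set (R * R) := [set v | hdist (to_disk f) v + hdist (to_disk g) v <= m].
have H p : 0 < depth p -> P (to_disk p) <-> confocal_disk f g tau p.
  move=> dp; rewrite /P /mkset !hdist_to_disk //; apply: (iff_trans (arcosh_add_le _ _ _)) => //;
    try exact: hdist_arg_ge1.
  rewrite /confocal_disk /confocal_form /mkset E0.
  have := sqr_sqrtr (ltW dp); have := sqr_sqrtr (ltW df); have := sqr_sqrtr (ltW dg).
  have sf0 := df; have sg0 := dg; have s0 := dp.
  rewrite -sqrtr_gt0 in sf0; rewrite -sqrtr_gt0 in sg0; rewrite -sqrtr_gt0 in s0.
  move: (Num.sqrt (depth f)) (Num.sqrt (depth g)) (Num.sqrt (depth p)) sf0 sg0 s0 => sf sg s.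
  move=> sf0 sg0 s0 <- <- <-.
  move: (polar f p) (polar g p) (cosh m) => a b M.
  have k0 : 0 < 4 * sf ^+ 2 * sg ^+ 2 * s ^+ 2 by rewrite !mulr_gt0 // exprn_gt0.
  have k1 : 0 < 4 * sf * sg * s ^+ 2 by rewrite !mulr_gt0 // exprn_gt0.
  have -> : (a / (2 * sf * s) * (b / (2 * sg * s)) <= M)
      = (a * b <= 2 * s ^+ 2 * (2 * sf * sg * M)).
    rewrite -subr_ge0 -[LHS](pmulr_rge0 _ k1) -[RHS]subr_ge0; congr (0 <= _).
    by field; rewrite !gt_eqF.
  have -> : (2 * (a / (2 * sf * s)) * (b / (2 * sg * s)) * M
      <= M ^+ 2 + (a / (2 * sf * s)) ^+ 2 + (b / (2 * sg * s)) ^+ 2 - 1)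
    = (0 <= ((2 * sf * sg * M) ^+ 2 - 4 * sf ^+ 2 * sg ^+ 2) * s ^+ 2
       + a ^+ 2 * sg ^+ 2 + b ^+ 2 * sf ^+ 2 - 2 * sf * sg * M * a * b).
    rewrite -subr_ge0 -[LHS](pmulr_rge0 _ k0); congr (0 <= _).
    by field; rewrite !gt_eqF.
  by split=> [[h1 h2]|[_ h1 h2]]; split=> //; rewrite ltW ?exprn_gt0.
apply/seteqP; split=> v.
  by move=> [vo hv]; apply/(to_disk_confocal (ltW df) (ltW dg) H); left.
move/(to_disk_confocal (ltW df) (ltW dg) H) => [//|[]] [d0 _];
  by move: df dg; rewrite d0 ltxx.
Qed.

Lemma parabolic_confocal f g k tau : 0 < depth f -> depth g = 0 ->
  polar f g + tau = expR k * Num.sqrt (depth f) * (g.2 + 1) ->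
  parabolic_set (to_disk f) (to_disk g) k = @to_disk R @` confocal_disk f g tau.
Proof.
move=> df dg E0.
have dg' : 0 <= depth g by rewrite dg.
pose P : set (R * R) :=
  [set v | hdist (to_disk f) v + horocycle_dist (to_disk g) k v <= 0].
have H p : 0 < depth p -> P (to_disk p) <-> confocal_disk f g tau p.
  move=> dp; rewrite /P /mkset /horocycle_dist hdist_to_disk // busemann_to_disk //.
  have hg := height_gt0 dg'.
  have b0 : 0 < polar g p.
    by rewrite polarE dg addr0 ltr_wpDl ?sqr_ge0.
  have s0 : 0 < Num.sqrt (depth p) by rewrite sqrtr_gt0.
  rewrite addrA subr_le0 -lerBrDr.
  apply: (iff_trans (arcosh_le_exp _ _)); first exact: hdist_arg_ge1.
  rewrite expRB lnK ?posrE ?divr_gt0 ?mulr_gt0 //.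
  rewrite /confocal_disk /confocal_form /mkset E0 dg.
  have := sqr_sqrtr (ltW dp); have := sqr_sqrtr (ltW df).
  have := df; rewrite -sqrtr_gt0 => sf0.
  move: (Num.sqrt (depth f)) (Num.sqrt (depth p)) sf0 s0 => sf s sf0 s0 <- <-.
  have := expR_gt0 k; move: (expR k) (g.2 + 1) hg (polar f p) (polar g p) b0.
  move=> K h h0 a b b0 K0.
  have k1 : 0 < 2 * sf * s * b by rewrite !mulr_gt0.
  have k0 : 0 < sf ^+ 2 * b ^+ 2 by rewrite !mulr_gt0 // exprn_gt0.
  have -> : (a / (2 * sf * s) <= K / (b / (s * h)))
      = (a * b <= 2 * s ^+ 2 * (K * sf * h)).
    rewrite -subr_ge0 -[LHS](pmulr_rge0 _ k1) -[RHS]subr_ge0; congr (0 <= _).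
    by field; rewrite !gt_eqF.
  have -> : (2 * (K / (b / (s * h))) * (a / (2 * sf * s))
      <= (K / (b / (s * h))) ^+ 2 + 1)
    = (0 <= ((K * sf * h) ^+ 2 - 4 * sf ^+ 2 * 0) * s ^+ 2 + a ^+ 2 * 0 +
       b ^+ 2 * sf ^+ 2 - K * sf * h * a * b).
    rewrite -subr_ge0 -[LHS](pmulr_rge0 _ k0); congr (0 <= _).
    by field; rewrite !gt_eqF.
  by split=> [[h1 h2]|[_ h1 h2]]; split=> //; rewrite ltW ?exprn_gt0.
apply/seteqP; split=> v.
  move=> hv; apply/(to_disk_confocal (ltW df) dg' H).
  by case: hv => [->|]; [right; right|left].
move/(to_disk_confocal (ltW df) dg' H) => [hv|[]]; first by right.
  by move=> [d0 _]; move: df; rewrite d0 ltxx.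
by move=> [_ ->]; left.
Qed.

Lemma horodisk_confocal f k tau : depth f = 0 ->
  tau = (expR k * (f.2 + 1)) ^+ 2 ->
  horodisk (to_disk f) k = @to_disk R @` confocal_disk f f tau.
Proof.
move=> df E0.
have df' : 0 <= depth f by rewrite df.
pose P : set (R * R) := [set v | busemann (to_disk f) v <= k].
have H p : 0 < depth p -> P (to_disk p) <-> confocal_disk f f tau p.
  move=> dp; rewrite /P /mkset busemann_to_disk //.
  have hf := height_gt0 df'.
  have b0 : 0 < polar f p.
    by rewrite polarE df addr0 ltr_wpDl ?sqr_ge0.
  have s0 : 0 < Num.sqrt (depth p) by rewrite sqrtr_gt0.
  rewrite -ler_expR lnK ?posrE ?divr_gt0 ?mulr_gt0 // ler_pdivrMr ?mulr_gt0 //.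
  rewrite /confocal_disk /confocal_form /mkset E0 df.
  have -> : polar f f = 0 by rewrite polarE subrr df expr0n !addr0.
  have := sqr_sqrtr (ltW dp).
  move: (Num.sqrt (depth p)) s0 => s s0 <-.
  have := expR_gt0 k; move: (expR k) (f.2 + 1) hf (polar f p) b0.
  move=> K h h0 a a0 K0.
  have k0 : 0 < (K * h) ^+ 2 by rewrite exprn_gt0 // mulr_gt0.
  have r0 : 0 < K * (s * h) by rewrite !mulr_gt0.
  rewrite -ler_sqr; [|by rewrite nnegrE ltW..].
  have -> : (a ^+ 2 <= (K * (s * h)) ^+ 2)
    = (0 <= ((0 + (K * h) ^+ 2) ^+ 2 - 4 * 0 * 0) * s ^+ 2 + a ^+ 2 * 0 + a ^+ 2 * 0
            - (0 + (K * h) ^+ 2) * a * a).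
    by rewrite -subr_ge0 -[LHS](pmulr_rge0 _ k0); congr (0 <= _); ring.
  split=> [h1|[_ _ h1] //]; split; [by rewrite ltW ?exprn_gt0| |exact: h1].
  rewrite -subr_ge0 -(pmulr_rge0 _ k0).
  have := sqr_ge0 ((K * h) ^+ 2 * s); lra.
apply/seteqP; split=> v.
  move=> hv; apply/(to_disk_confocal df' df' H).
  by case: hv => [->|]; [right; right|left].
by move/(to_disk_confocal df' df' H) => [hv|[]]; [right|move=> [_ ->]; left..].
Qed.

Lemma point_confocal f : depth f = 0 ->
  [set to_disk f] = @to_disk R @` confocal_disk f f 0.
Proof.
move=> df.
have df' : 0 <= depth f by rewrite df.
have H p : 0 < depth p -> (set0 : set (R * R)) (to_disk p) <-> confocal_disk f f 0 p.
  move=> dp; split=> // -[_ + _].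
  rewrite (polarE f p) (polarE f f) subrr df expr0n !addr0 mulr0.
  have := sqr_ge0 (p.1 - f.1); nra.
apply/seteqP; split=> v.
  by move=> ->; apply/(to_disk_confocal df' df' H); right; right.
by move/(to_disk_confocal df' df' H) => [[] //|[]] [_ ->].
Qed.

Lemma hypercyclic_confocal f g r tau : depth f = 0 -> depth g = 0 -> f <> g -> 0 <= r ->
  polar f g + tau = polar f g * cosh r ^+ 2 ->
  hypercyclic_set (to_disk f) (to_disk g) r = @to_disk R @` confocal_disk f g tau.
Proof.
move=> df dg fg r0 E0.
have df' : 0 <= depth f by rewrite df.
have dg' : 0 <= depth g by rewrite dg.
pose P : set (R * R) := [set v | hdist_set v (hline (to_disk f) (to_disk g)) <= r].
have H p : 0 < depth p -> P (to_disk p) <-> confocal_disk f g tau p.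
  move=> dp; rewrite /P /mkset.
  have [Q1 ->] := hdist_set_hline df dg fg dp.
  rewrite arcosh_le //.
  have Ef := polar_boundary_gt0 df dp; have Eg := polar_boundary_gt0 dg dp.
  have Efg := polar_two_boundary df dg fg.
  have C1 := cosh_ge1 r.
  rewrite -ler_sqr ?nnegrE ?sqrtr_ge0 //; last by lra.
  rewrite sqr_sqrtr; last by rewrite divr_ge0 ?mulr_ge0 ?ltW.
  rewrite ler_pdivrMr ?mulr_gt0 //.
  rewrite /confocal_disk /confocal_form /mkset E0 df dg.
  have M0 : 0 < polar f g * cosh r ^+ 2 by rewrite mulr_gt0 // exprn_gt0 //; lra.
  have -> : cosh r ^+ 2 * (polar f g * depth p) = polar f g * cosh r ^+ 2 * depth p by ring.
  move: (polar f g * _) M0 (polar f p) (polar g p) Ef Eg => M M0 a b a0 b0.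
  have -> : (M ^+ 2 - 4 * 0 * 0) * depth p + a ^+ 2 * 0 + b ^+ 2 * 0 - M * a * b
     = M * (M * depth p - a * b) by ring.
  have Md : 0 <= M * depth p by rewrite mulr_ge0 ?ltW.
  by rewrite pmulr_rge0 //; split=> [h|[_ _ h]]; [split; lra|lra].
apply/seteqP; split=> v.
  move=> hv; apply/(to_disk_confocal df' dg' H).
  by case: hv => [[->|->]|]; [right; left|right; right|left].
move/(to_disk_confocal df' dg' H) => [hv|[]]; first by right.
  by move=> [_ ->]; left; left.
by move=> [_ ->]; left; right.
Qed.

Lemma exp_surj (x : R) : 0 < x -> exists k, expR k = x.
Proof. by move=> x0; exists (ln x); apply: lnK; rewrite posrE. Qed.

(** The bounds on the size parameters in the family express that tau >= 0;
    for a single asymptotic focus the value tau = 0 is the point and the values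
    tau > 0 are the horodisks. *)
Lemma family_confocal f g K : 0 <= depth f -> 0 <= depth g ->
  family_bck (to_disk f) (to_disk g) K <->
  exists2 tau, 0 <= tau & K = @to_disk R @` confocal_disk f g tau.
Proof.
move=> df dg; split.
  case=> {K}.
  - move=> m /(ordinary_to_disk df) df' /(ordinary_to_disk dg) dg'.
    rewrite hdist_to_disk // => h.
    have m0 : 0 <= m by apply: le_trans h; rewrite arcosh_ge0 // hdist_arg_ge1.
    have k0 : 0 < 2 * Num.sqrt (depth f) * Num.sqrt (depth g) by rewrite !mulr_gt0 ?sqrtr_gt0.
    rewrite arcosh_le ?hdist_arg_ge1 // ler_pdivrMr // in h.
    exists (cosh m * (2 * Num.sqrt (depth f) * Num.sqrt (depth g)) - polar f g).
      by rewrite subr_ge0.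
    by apply: elliptic_confocal => //; ring.
  - move=> k /(ordinary_to_disk df) df' /(asymptotic_to_disk dg) dg'.
    rewrite horocycle_le // => h.
    exists (expR k * Num.sqrt (depth f) * (g.2 + 1) - polar f g); first by rewrite subr_ge0.
    by apply: parabolic_confocal => //; ring.
  - move=> k /(asymptotic_to_disk df) df' /(ordinary_to_disk dg) dg'.
    rewrite horocycle_le // => h.
    exists (expR k * Num.sqrt (depth g) * (f.2 + 1) - polar g f); first by rewrite subr_ge0.
    by rewrite confocal_diskC; apply: parabolic_confocal => //; ring.
  - move=> r /(asymptotic_to_disk df) df' /(asymptotic_to_disk dg) dg' fg r0.
    have fg' : f <> g by move=> e; apply: fg; rewrite e.
    exists (polar f g * cosh r ^+ 2 - polar f g).
      rewrite subr_ge0 ler_peMr ?(ltW (polar_two_boundary _ _ _)) //.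
      by have := cosh_ge1 r; nra.
    by apply: hypercyclic_confocal => //; ring.
  - move=> /(asymptotic_to_disk df) df' /(to_disk_inj df dg) <-.
    by exists 0 => //; exact: point_confocal.
  - move=> k /(asymptotic_to_disk df) df' /(to_disk_inj df dg) <-.
    by exists ((expR k * (f.2 + 1)) ^+ 2); [exact: sqr_ge0|exact: horodisk_confocal].
move=> [tau tau0 ->].
have [f0|fn0] := eqVneq (depth f) 0; have [g0|gn0] := eqVneq (depth g) 0.
- have aF : asymptotic (to_disk f) by apply/asymptotic_to_disk.
  have aG : asymptotic (to_disk g) by apply/asymptotic_to_disk.
  have [fg|/eqP fg] := eqVneq f g.
    subst g; have [->|tn0] := eqVneq tau 0.
      by rewrite -point_confocal //; apply: EqualAsymptoticPoint.
    have t0 : 0 < tau by rewrite lt_def tn0.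
    have hf := height_gt0 df.
    have [k kE] : exists k, expR k = Num.sqrt tau / (f.2 + 1).
      by apply: exp_surj; rewrite divr_gt0 ?sqrtr_gt0.
    rewrite -(@horodisk_confocal _ k) //; first exact: EqualAsymptoticHorodisk.
    by rewrite kE divfK ?gt_eqF // sqr_sqrtr.
  have E := polar_two_boundary f0 g0 fg.
  have [r r0 rE] : exists2 r, 0 <= r & cosh r = Num.sqrt (1 + tau / polar f g).
    by apply: cosh_surj; rewrite -[X in X <= _]sqrtr1 ler_sqrt ?lerDl ?addr_ge0 ?divr_ge0 // ltW.
  rewrite -(@hypercyclic_confocal _ _ r) //.
    by apply: TwoAsymptotic => //; move/(to_disk_inj df dg).
  rewrite rE sqr_sqrtr ?addr_ge0 ?divr_ge0 ?(ltW E) //.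
  by field; rewrite gt_eqF.
- have dg' : 0 < depth g by rewrite lt_def gn0.
  have hf := height_gt0 df.
  have s0 : 0 < Num.sqrt (depth g) by rewrite sqrtr_gt0.
  have E : 0 < polar g f by rewrite polarC polar_boundary_gt0.
  have [k kE] : exists k, expR k = (polar g f + tau) / (Num.sqrt (depth g) * (f.2 + 1)).
    by apply: exp_surj; rewrite divr_gt0 ?mulr_gt0 // ltr_pwDl.
  have kE' : polar g f + tau = expR k * Num.sqrt (depth g) * (f.2 + 1).
    by rewrite kE; field; rewrite !gt_eqF.
  rewrite confocal_diskC -(@parabolic_confocal _ _ k) //.
  apply: AsymptoticOrdinary; first by apply/asymptotic_to_disk.
    by apply/ordinary_to_disk.
  by rewrite horocycle_le // -kE' lerDl.
- have df' : 0 < depth f by rewrite lt_def fn0.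
  have hg := height_gt0 dg.
  have s0 : 0 < Num.sqrt (depth f) by rewrite sqrtr_gt0.
  have E : 0 < polar f g by rewrite polarC polar_boundary_gt0.
  have [k kE] : exists k, expR k = (polar f g + tau) / (Num.sqrt (depth f) * (g.2 + 1)).
    by apply: exp_surj; rewrite divr_gt0 ?mulr_gt0 // ltr_pwDl.
  have kE' : polar f g + tau = expR k * Num.sqrt (depth f) * (g.2 + 1).
    by rewrite kE; field; rewrite !gt_eqF.
  rewrite -(@parabolic_confocal _ _ k) //.
  apply: OrdinaryAsymptotic; [by apply/ordinary_to_disk|by apply/asymptotic_to_disk|].
  by rewrite horocycle_le // -kE' lerDl.
have df' : 0 < depth f by rewrite lt_def fn0.
have dg' : 0 < depth g by rewrite lt_def gn0.
have k0 : 0 < 2 * Num.sqrt (depth f) * Num.sqrt (depth g) by rewrite !mulr_gt0 ?sqrtr_gt0.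
have [m m0 mE] : exists2 m, 0 <= m & cosh m
   = (polar f g + tau) / (2 * Num.sqrt (depth f) * Num.sqrt (depth g)).
  apply: cosh_surj; rewrite ler_pdivlMr // mul1r.
  by rewrite (le_trans (polar_ge df dg)) // lerDl.
rewrite -(@elliptic_confocal _ _ m) //; last first.
  by rewrite mE mulrC divfK // gt_eqF.
apply: TwoOrdinary; [by apply/ordinary_to_disk|by apply/ordinary_to_disk|].
rewrite hdist_to_disk // arcosh_le ?hdist_arg_ge1 // mE ler_pM2r ?invr_gt0 //.
by rewrite lerDl.
Qed.

(** Every set in the image of family_confocal avoids the point (0, 1), so the
    ideal point belongs to no member of the family. *)
Lemma family_pck_confocal f g K : 0 <= depth f -> 0 <= depth g ->
  family_pck (Some f) (Some g) K <->
  exists2 tau, 0 <= tau & K = Some @` confocal_disk f g tau.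
Proof.
move=> df dg; rewrite /family_pck.
have img (L : set (R * R)) : @pck_to_bck R @` (Some @` L) = @to_disk R @` L.
  by rewrite image_comp.
split=> [[Kb /(family_confocal _ df dg)[tau tau0 E]]|[tau tau0 ->]].
  exists tau => //; apply/seteqP; split=> [q Kq|_ [p cp <-]].
    have : (@to_disk R @` confocal_disk f g tau) (pck_to_bck q).
      by rewrite -E; exists q.
    move=> [p cp]; case: q Kq (Kb _ Kq) => [[x z] Kq xz e|Kq _ e].
      exists p => //; congr Some; apply: to_disk_inj e; first exact: confocal_disk_depth cp.
      by rewrite /depth subr_ge0.
    by case: (to_disk_neq_ideal (confocal_disk_depth cp)).
  have : (@pck_to_bck R @` K) (to_disk p) by rewrite E; exists p.
  move=> [q Kq e]; suff <- : q = Some p by [].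
  case: q Kq (Kb _ Kq) e => [[x z] Kq xz e|Kq _ e].
    congr Some; apply: to_disk_inj e; last exact: confocal_disk_depth cp.
    by rewrite /depth subr_ge0.
  by case: (to_disk_neq_ideal (confocal_disk_depth cp)).
split; last by rewrite img; apply/family_confocal => //; exists tau.
by move=> _ [[x z] /confocal_disk_depth + <-]; rewrite /depth subr_ge0.
Qed.
End Family.

(** * Triangular form and the conformal range *)

Section Triangular.
Variables (R : realType) (V : vectType R[i])
    (ip : {dot V for Num.conj}) (A : 'End(V)).

Lemma ip_combl (a b : R[i]) (u v w : V) : ip (a *: u + b *: v) w = a * ip u w + b * ip v w.
Proof. by rewrite linearDl !linearZl_LR. Qed.

Lemma ip_combr (a b : R[i]) (u v w : V) :
  ip w (a *: u + b *: v) = conjc a * ip w u + conjc b * ip w v.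
Proof. by rewrite linearDr !linearZr_LR. Qed.

Lemma ipC u v : ip u v = conjc (ip v u).
Proof. by rewrite hermC /= expr0 mul1r. Qed.

Lemma ip_real u : ip u u = (normsq ip u)%:C%C.
Proof. by have := dnorm_ge0 ip u; rewrite RRe_real //; exact: ger0_real. Qed.

Lemma normsq_gt0 u : u != 0 -> 0 < normsq ip u.
Proof. by move=> u0; rewrite -ltcR -ip_real dnorm_gt0. Qed.

Lemma normsq_ge0 u : 0 <= normsq ip u.
Proof. by rewrite -lecR -ip_real dnorm_ge0. Qed.

(** The characteristic polynomial enters the argument only through its set of
    roots; in dimension two with a triangular form this already determines both
    diagonal entries. *)
Lemma eigen_root (l1 l2 l : R[i]) :
   char_poly (passmx.mxof (vbasis {:V}) (vbasis {:V}) A)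
            = ('X - l1%:P) * ('X - l2%:P) ->
  (exists2 w, w != 0 & A w = l *: w) <-> (l == l1) || (l == l2).
Proof.
move=> E.
have bV := vbasisP {:V}.
have -> : (l == l1) || (l == l2) =
  root (char_poly (passmx.mxof (vbasis {:V}) (vbasis {:V}) A)) l.
  by rewrite E rootM !root_XsubC.
rewrite -eigenvalue_root_char; split.
  move=> [w w0 Aw]; apply/eigenvalueP; exists (passmx.rVof (vbasis {:V}) w).
    rewrite -passmx.rVof_app // Aw. by apply/rowP => i; rewrite !mxE linearZ.
  by rewrite passmx.rVof_eq0.
move/eigenvalueP => [v vM v0]; exists (passmx.vecof (vbasis {:V}) v).
  by rewrite passmx.vecof_eq0.
rewrite (passmx.hom_vecof _ bV) vM /passmx.vecof scaler_sumr; apply: eq_bigr => i _.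
by rewrite mxE scalerA.
Qed.

Lemma unit_multiple (w : V) : w != 0 -> exists2 c : R[i], c != 0 & ip (c *: w) (c *: w) = 1.
Proof.
move=> w0; have n0 : 0 < ip w w by rewrite dnorm_gt0.
exists (sqrtC (ip w w))^-1; first by rewrite invr_eq0 sqrtC_eq0 gt_eqF.
rewrite dnormZ ger0_norm ?invr_ge0 ?sqrtC_ge0 ?ltW // exprVn sqrtCK mulVf //.
by rewrite gt_eqF.
Qed.

Lemma schur (l1 l2 : R[i]) : \dim {:V} = 2%N ->
   char_poly (passmx.mxof (vbasis {:V}) (vbasis {:V}) A)
            = ('X - l1%:P) * ('X - l2%:P) ->
  exists e1 e2 t, [/\ ip e1 e1 = 1, ip e2 e2 = 1, ip e1 e2 = 0, 0 <= t
   & [/\ A e1 = l1 *: e1, A e2 = t%:C%C *: e1 + l2 *: e2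
    & forall u, exists a b, u = a *: e1 + b *: e2]].
Proof.
move=> dimV E.
have [w w0 Aw] : exists2 w, w != 0 & A w = l1 *: w.
  by apply/(eigen_root l1 E); rewrite eqxx.
have [c c0 n1] := unit_multiple w0.
set e1 := c *: w in n1.
have Ae1 : A e1 = l1 *: e1 by rewrite /e1 linearZ /= Aw !scalerA mulrC.
have e10 : e1 != 0 by rewrite scaler_eq0 negb_or c0.
have /subvPn[v _ ve1] : ~~ (fullv <= <[e1]>)%VS.
  by apply/negP => /dimvS; rewrite dimV dim_vline; case: (e1 != 0).
have v0 : v - ip v e1 *: e1 != 0.
  by apply: contra ve1; rewrite subr_eq0 => /eqP ->; rewrite memvZ ?memv_line.
have [d d0 n2] := unit_multiple v0.
set f2 := d *: _ in n2.
have o : ip f2 e1 = 0.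
  by rewrite linearZl_LR /= linearBl linearZl_LR /= n1 mulr1 subrr mulr0.
have o' : ip e1 f2 = 0 by rewrite ipC o conjc0.
have span (u : V) : exists a b, u = a *: e1 + b *: f2.
  have fr : free [:: e1; f2].
    apply: (@orthonormal_free _ _ ip).
    by rewrite /orthonormal /= n1 n2 o' !eqxx.
  have : u \in <<[:: e1; f2]>>%VS.
    have -> : <<[:: e1; f2]>>%VS = fullv; last exact: memvf.
    by apply/eqP; rewrite eqEdim subvf dimV (eqP fr).
  rewrite span_cons span_seq1 => /memv_addP[x /vlineP[a ->] [y /vlineP[b ->] ->]].
  by exists a, b.
have [tau [mu Af2]] := span (A f2).
have f20 : f2 != 0 by rewrite scaler_eq0 negb_or d0.
clearbody f2; clearbody e1.
(* The entry mu is an eigenvalue.  If it equals l1, then l1 is the only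
   eigenvalue, hence l2 = l1. *)
have mul : mu = l2.
  have eqs a b a' b' : a *: e1 + b *: f2 = a' *: e1 + b' *: f2 -> b = b'.
    move=> H; have := congr1 (fun x => ip x f2) H.
    by rewrite !ip_combl o' n2 !mulr0 !mulr1 !add0r.
  have eqs1 a b a' b' : a *: e1 + b *: f2 = a' *: e1 + b' *: f2 -> a = a'.
    move=> H; have := congr1 (fun x => ip x e1) H.
    by rewrite !ip_combl o n1 !mulr0 !mulr1 !addr0.
  have Acomb a b : A (a *: e1 + b *: f2) = (a * l1 + b * tau) *: e1 + (b * mu) *: f2.
    by rewrite linearD !linearZ /= Ae1 Af2 scalerDr !scalerA scalerDl addrA.
  have [m1|mn1] := eqVneq mu l1; last first.
    have : (mu == l1) || (mu == l2).
      apply/(eigen_root mu E); exists ((tau / (mu - l1)) *: e1 + 1 *: f2).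
        apply/eqP => H; have : (1 : R[i]) = 0; last by move/eqP; rewrite oner_eq0.
        by apply: (@eqs (tau / (mu - l1)) 1 0 0); rewrite H !scale0r addr0.
      rewrite Acomb scalerDr !scalerA !mul1r mulr1; congr (_ *: _ + _).
      have mn : mu - l1 != 0 by rewrite subr_eq0.
      by field.
    by case/orP=> /eqP // mul1; case/eqP: mn1.
  have [x x0 Ax] : exists2 w, w != 0 & A w = l2 *: w.
    by apply/(eigen_root l2 E); rewrite eqxx orbT.
  have [a [b xE]] := span x.
  move: Ax; rewrite xE Acomb scalerDr !scalerA => H.
  have h2 := eqs _ _ _ _ H; have h1 := eqs1 _ _ _ _ H.
  have [b0|bn0] := eqVneq b 0; last first.
    by apply: (mulfI bn0); rewrite h2 mulrC.
  have an0 : a != 0 by apply: contra x0 => /eqP a0; rewrite xE a0 b0 !scale0r addr0.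
  rewrite m1; apply: (mulfI an0); move: h1; rewrite b0 mul0r addr0 => ->.
  by rewrite mulrC.
rewrite mul in Af2.
(* A phase factor on the second basis vector makes the entry tau nonnegative. *)
have [om om1 omt] : exists2 om : R[i], `|om| = 1 & om * tau = `|tau|.
  have [->|tn0] := eqVneq tau 0; first by exists 1; rewrite ?normr1 // mulr0 normr0.
  exists (`|tau| / tau); last by rewrite divfK.
  by rewrite normrM normrV ?unitfE // normr_id divff // normr_eq0.
have omn0 : om != 0 by rewrite -normr_eq0 om1 oner_eq0.
exists e1, (om *: f2), (Num.sqrt ((complex.Re tau)^+2 + (complex.Im tau)^+2)).
split=> //.
- by rewrite dnormZ om1 n2 expr1n mulr1.
- by rewrite linearZr_LR /= o' mulr0.
- split=> //.
    by rewrite linearZ /= Af2 scalerDr !scalerA omt normc_def mulrC.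
  move=> u; have [a [b ->]] := span u; exists a, (b / om).
  by rewrite scalerA divfK.
Qed.
End Triangular.

Section Range.
Variables (R : realType) (V : vectType R[i])
    (ip : {dot V for Num.conj}) (A : 'End(V)).

Definition dw_point (u : V) : R * R :=
  (complex.Re (ip (A u) u) / normsq ip u, normsq ip (A u) / normsq ip u).

(** Unit vectors up to a phase correspond to the points of the sphere
    u^2 + v^2 = a b, a + b = 1. *)
Lemma dw_shell (l1 l2 : R[i]) (dimV : \dim {:V} = 2%N)
    (eigA : char_poly (passmx.mxof (vbasis {:V}) (vbasis {:V}) A)
            = ('X - l1%:P) * ('X - l2%:P)) :
  exists2 t, 0 <= t & [set dw_point u | u in [set u : V | u != 0]] =
    shell (complex.Re l1) (complex.Im l1) (complex.Re l2) (complex.Im l2) t.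
Proof.
have [e1 [e2 [t [n1 n2 o12 t0 [A1 A2 span]]]]] := schur ip dimV eigA.
have o21 : ip e2 e1 = 0 by rewrite ipC o12 conjc0.
have ipE a b a' b' : ip (a *: e1 + b *: e2) (a' *: e1 + b' *: e2)
   = a * conjc a' + b * conjc b'.
  by rewrite ip_combl !ip_combr n1 n2 o12 o21; ring.
have AE a b : A (a *: e1 + b *: e2) = (a * l1 + b * t%:C%C) *: e1 + (b * l2) *: e2.
  by rewrite linearD !linearZ /= A1 A2 scalerDr !scalerA scalerDl addrA.
exists t => //; apply/seteqP; split.
  move=> _ [u u0 <-]; have := normsq_gt0 ip u0; rewrite /dw_point.
  have [[ar ai] [[br bi] ->]] := span u.
  rewrite AE /normsq !ipE /=; clear eigA A1 A2 AE span; case: l1 l2 => [x1 y1] [x2 y2] /=.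
  set n := (X in 0 < X) => n0.
  have nE : n = ar ^+ 2 + ai ^+ 2 + br ^+ 2 + bi ^+ 2 by rewrite /n; ring.
  have nn0 : n != 0 by rewrite gt_eqF.
  exists ((ar ^+ 2 + ai ^+ 2) / n), ((br ^+ 2 + bi ^+ 2) / n),
    ((br * ar + bi * ai) / n), ((bi * ar - br * ai) / n).
  move: nE; clearbody n => nE; split.
  - by rewrite -mulrDl addrA -nE divff.
  - by rewrite divr_ge0 ?addr_ge0 ?sqr_ge0 // ltW.
  - by rewrite divr_ge0 ?addr_ge0 ?sqr_ge0 // ltW.
  - by field.
  - have -> : ar * ar - ai * - ai + (br * br - bi * - bi) = n by rewrite nE; ring.
    by rewrite /shell_point; congr pair; field.
move=> p [a [b [u [v [ab a0 b0 uv ->]]]]].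
have [a' [b' [E1 E2 E3]]] : exists a' b' : R[i], [/\ complex.Re (a' * conjc a') = a,
    complex.Re (b' * conjc b') = b & b' * conjc a' = (u +i* v)%C].
  have [a00|an0] := eqVneq a 0.
    exists 0, 1; rewrite a00 mul0r in uv.
    have := sqr_ge0 u; have := sqr_ge0 v => v0 u0.
    have /eqP : u ^+ 2 = 0 by lra.
    have /eqP : v ^+ 2 = 0 by lra.
    rewrite !sqrf_eq0 => /eqP -> /eqP ->; split.
    + by rewrite mul0r a00.
    + by rewrite conjc1 mulr1 /=; lra.
    + by rewrite conjc0 mulr0.
  have sa0 : Num.sqrt a != 0 by rewrite sqrtr_eq0 -ltNge lt_def an0.
  exists (Num.sqrt a)%:C%C, ((u / Num.sqrt a) +i* (v / Num.sqrt a))%C; split => /=.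
  - by rewrite oppr0 mulr0 subr0 -expr2 sqr_sqrtr.
  - transitivity ((u ^+ 2 + v ^+ 2) / Num.sqrt a ^+ 2); first by field.
    by rewrite uv sqr_sqrtr // mulrC mulKf.
  - by apply/eqP; rewrite eq_complex /=; apply/andP; split; apply/eqP; field.
have n1' : normsq ip (a' *: e1 + b' *: e2) = 1.
  by rewrite /normsq ipE raddfD /= E1 E2.
exists (a' *: e1 + b' *: e2).
  apply: contraTneq (oner_neq0 R) => w0.
  by rewrite -n1' w0 /normsq linear0l eqxx.
rewrite /dw_point n1' !divr1 /normsq AE !ipE /shell_point.
clear eigA A1 A2 AE span n1'; case: l1 l2 a' b' E1 E2 E3 => [x1 y1] [x2 y2] [ar ai] [br bi] /= E1 E2 [E3 E4].
by rewrite -E1 -E2 -E3 -E4; congr pair; ring.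
Qed.

Lemma opnorm_sqr (c : R) :
  touches_below_bck c [set dw_point u | u in [set u : V | u != 0]] ->
  opnorm ip A ^+ 2 = c.
Proof.
move=> [ub [_ [[u u0 <-] uc]]].
have ratio (w : V) : w != 0 -> Num.sqrt (normsq ip (A w)) / Num.sqrt (normsq ip w)
    = Num.sqrt (normsq ip (A w) / normsq ip w).
  by move=> w0; rewrite sqrtrM ?normsq_ge0 // sqrtrV // ltW // normsq_gt0.
have c0 : 0 <= c by rewrite -uc /= divr_ge0 ?normsq_ge0.
suff -> : opnorm ip A = Num.sqrt c by rewrite sqr_sqrtr.
have mem : [set Num.sqrt (normsq ip (A u)) / Num.sqrt (normsq ip u)
      | u in [set u : V | u != 0]] (Num.sqrt c).
  by exists u => //; rewrite ratio //; congr Num.sqrt.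
have bnd : ubound [set Num.sqrt (normsq ip (A u)) / Num.sqrt (normsq ip u)
      | u in [set u : V | u != 0]] (Num.sqrt c).
  move=> _ [w w0 <-]; rewrite ratio // ler_wsqrtr //.
  by apply: (ub (dw_point w)); exists w.
apply/le_anti; rewrite ge_sup //=; last by exists (Num.sqrt c).
by apply: ub_le_sup => //; exists (Num.sqrt c).
Qed.

Lemma DW_pck_point : DW_pck ip A = Some @` [set dw_point u | u in [set u : V | u != 0]].
Proof. by rewrite image_comp. Qed.

Lemma DW_bck_point : DW_bck ip A =
  (fun p => pck_to_bck (Some p)) @` [set dw_point u | u in [set u : V | u != 0]].
Proof.
rewrite image_comp; apply: eq_imagel => u u0 /=.
have n0 := normsq_gt0 ip u0; have m0 := normsq_ge0 ip (A u).
by congr pair; field; rewrite !gt_eqF // ltr_wpDl.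
Qed.
End Range.

(** * Touching the line *)

Lemma touches_below_Some (R : realType) (c : R) (K : set (R * R)) :
  touches_below_pck c (Some @` K) <-> touches_below_bck c K.
Proof.
split=> [[h [_ [[p Kp <-] [q qc [qp]]]]]|[h [p [Kp pc]]]].
  split=> [r Kr|]; last by exists p; split=> //; rewrite -qp.
  by have [|s sc [<-]] := h (Some r); first by exists r.
split=> [_ [r Kr <-]|]; first by exists r => //; apply: h.
by exists (Some p); split; exists p.
Qed.

(** The height (z - 1) / (z + 1) = 1 - 2 / (z + 1) is increasing in z. *)
Lemma touches_below_to_disk (R : realType) (c : R) (K : set (R * R)) : 0 <= c ->
  (forall p, K p -> 0 <= depth p) ->
  touches_below_bck ((c - 1) / (c + 1)) (@to_disk R @` K) <-> touches_below_bck c K.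
Proof.
move=> c0 Kd; have c1 : 0 < c + 1 by lra.
have e (y : R) : 0 < y + 1 -> (y - 1) / (y + 1) = 1 - 2 / (y + 1).
  by move=> y1; field; rewrite gt_eqF.
have le p : K p -> ((to_disk p).2 <= (c - 1) / (c + 1)) = (p.2 <= c).
  move=> /Kd /height_gt0; case: p => x z /= z1.
  by rewrite !e // lerD2l lerN2 ler_pM2l // lef_pV2 // lerD2r.
have eq p : K p -> ((to_disk p).2 = (c - 1) / (c + 1)) <-> (p.2 = c).
  move=> /Kd /height_gt0; case: p => x z /= z1; split=> [|-> //].
  rewrite !e // => /addrI /oppr_inj /mulfI.
  by rewrite pnatr_eq0 => /(_ isT) /invr_inj; lra.
split=> [[h [_ [[p Kp <-] pc]]]|[h [p [Kp pc]]]].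
  split=> [r Kr|]; last by exists p; split=> //; apply/(eq p Kp).
  by rewrite /mkset -le //; apply: h; exists r.
split=> [_ [r Kr <-]|]; first by rewrite /mkset le //; apply: h.
by exists (to_disk p); split; [exists p|apply/eq].
Qed.

Section Transport.
Variable R : realType.
Implicit Types l : R[i].

Definition eigen_point l : R * R := parab (complex.Re l) (complex.Im l).

Lemma abssqE l : abssq l = complex.Re l ^+ 2 + complex.Im l ^+ 2.
Proof. by rewrite /abssq -add_Re2_Im2. Qed.

Lemma iota_pckE l : iota_pck l = Some (eigen_point l).
Proof. by rewrite /iota_pck abssqE. Qed.

Lemma iota_bckE l : iota_bck l = to_disk (eigen_point l).
Proof. by rewrite /iota_bck abssqE. Qed.

Lemma eigen_point_depth l : 0 <= depth (eigen_point l).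
Proof. by rewrite depth_parab sqr_ge0. Qed.

End Transport.

Theorem theorem2p8 (R : realType) (V : vectType R[i])
    (ip : {dot V for Num.conj}) (A : 'End(V)) (l1 l2 : R[i])
    (dimV : \dim {:V} = 2%N)
    (eigA : char_poly (passmx.mxof (vbasis {:V}) (vbasis {:V}) A)
            = ('X - l1%:P) * ('X - l2%:P)) :
  unique (fun K : set (option (R * R)) =>
            family_pck (iota_pck l1) (iota_pck l2) K
            /\ touches_below_pck (opnorm ip A ^+ 2) K)
         (DW_pck ip A)
  /\
  unique (fun K : set (R * R) =>
            family_bck (iota_bck l1) (iota_bck l2) K
            /\ touches_below_bck
                 ((opnorm ip A ^+ 2 - 1) / (opnorm ip A ^+ 2 + 1)) K)
         (DW_bck ip A).
Proof.
have [t t0 DW] := dw_shell ip dimV eigA.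
have [c [_ _ top]] := shell_top (complex.Re l1) (complex.Im l1) (complex.Re l2)
  (complex.Im l2) t0.
have cE : opnorm ip A ^+ 2 = c by apply: opnorm_sqr; rewrite DW.
have c0 : 0 <= c by rewrite -cE sqr_ge0.
rewrite DW_pck_point DW_bck_point DW cE !iota_pckE !iota_bckE -/(@to_disk R).
have d1 := eigen_point_depth l1; have d2 := eigen_point_depth l2.
have shellE := shell_confocal (complex.Re l1) (complex.Im l1) (complex.Re l2) (complex.Im l2).
have uniq_tau tau : 0 <= tau ->
    touches_below_bck c (confocal_disk (eigen_point l1) (eigen_point l2) tau) ->
    tau = t ^+ 2.
  move=> tau0 h; have s0 := sqrtr_ge0 tau.
  suff -> : t = Num.sqrt tau by rewrite sqr_sqrtr.
  apply: shell_touch_inj top _ => //.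
  by rewrite shellE // sqr_sqrtr.
rewrite shellE // in top *; split; split.
- split; last by apply/touches_below_Some.
  by apply/family_pck_confocal => //; exists (t ^+ 2) => //; apply: sqr_ge0.
- move=> K [/(family_pck_confocal _ d1 d2)[tau tau0 ->] /touches_below_Some h].
  by rewrite (uniq_tau _ tau0 h).
- split.
    by apply/family_confocal => //; exists (t ^+ 2) => //; apply: sqr_ge0.
  by apply/touches_below_to_disk => // p; apply: confocal_disk_depth.
move=> K [/(family_confocal _ d1 d2)[tau tau0 ->]].
move=> /(touches_below_to_disk c0 (@confocal_disk_depth _ _ _ _)) h.
by rewrite (uniq_tau _ tau0 h).
Qed.
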